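(* In the category $\mathrm{Fun}$ of functors from finitely generated free abelian groups to abelian groups, $$\operatorname{Ext}^1_{\mathrm{Fun}}(\Gamma^4,S^4)\cong\mathbb{Z}/2\oplus\mathbb{Z}/3 .$$
   Context: $\mathrm{Fun}$ is the abelian category of all functors from finitely generated free $\mathbb{Z}$-modules to $\mathbb{Z}$-modules. $S^4$ and $\Gamma^4$ denote the fourth symmetric power and fourth divided power functors over $\mathbb{Z}$. *)

(* Defs.v *)
From HB Require Import structures.
From mathcomp Require Import fingroup perm all_boot all_algebra.
From mathcomp Require Import boolp.

Set Implicit Arguments.
Unset Strict Implicit.
Unset Printing Implicit Defensive.

Import GRing.Theory.
Import VectorInternalTheory.

Local Open Scope ring_scope.
Local Open Scope quotient_scope.

Implicit Types U V W : vectType int.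

(* A [vectType int] is an abelian group together with an isomorphism [v2r] to
   some Z^n, and ['Hom(U, V)] is the type of all additive maps U -> V.  The
   isomorphism is not required to be preserved by anything, so these are the
   objects and arrows of the category of finitely generated free Z-modules. *)
Record Fun := MkFun {
  fobj :> vectType int -> zmodType;
  fmap : forall U V, 'Hom(U, V) -> {additive fobj U -> fobj V};
  fmap_id : forall U (x : fobj U), fmap \1%VF x = x;
  fmap_comp : forall U V W (g : 'Hom(V, W)) (f : 'Hom(U, V))
    (x : fobj U), fmap (g \o f)%VF x = fmap g (fmap f x)
}.
Arguments fmap F {U V} f : rename.

Record nat_trans (F G : Fun) := MkNat {
  nt :> forall V, {additive F V -> G V};
  nt_natural : forall U V (f : 'Hom(U, V)) (x : F U),
    nt V (fmap F f x) = fmap G f (nt U x)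
}.

Section DirectSum.
Variables F G : Fun.

Definition dsum_map U V (f : 'Hom(U, V)) (x : F U * G U) :
  F V * G V := (fmap F f x.1, fmap G f x.2).

Fact dsum_map_is_zmod_morphism U V f : zmod_morphism (@dsum_map U V f).
Proof. by move=> x y; rewrite /dsum_map /= !raddfB. Qed.

HB.instance Definition _ U V f :=
  GRing.isZmodMorphism.Build (F U * G U)%type (F V * G V)%type
    (@dsum_map U V f) (@dsum_map_is_zmod_morphism U V f).

Fact dsum_map_id U x : dsum_map (\1%VF : 'Hom(U, U)) x = x.
Proof. by case: x => x y; rewrite /dsum_map /= !fmap_id. Qed.

Fact dsum_map_comp U V W (g : 'Hom(V, W)) (f : 'Hom(U, V)) x :
  dsum_map (g \o f)%VF x = dsum_map g (dsum_map f x).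
Proof. by rewrite /dsum_map /= !fmap_comp. Qed.

Definition dsum : Fun :=
  @MkFun (fun V => (F V * G V)%type) (fun U V f => @dsum_map U V f)
    dsum_map_id dsum_map_comp.

Lemma dsumB V (x y : dsum V) : x - y = (x.1 - y.1, x.2 - y.2).
Proof. by []. Qed.

End DirectSum.

Record subfunctor (F : Fun) := MkSub {
  sub_pred : forall V, {pred F V};
  sub_zmod_closed : forall V, zmod_closed (@sub_pred V);
  sub_stable : forall U V (f : 'Hom(U, V)) (x : F U),
    x \in @sub_pred U -> fmap F f x \in @sub_pred V
}.
Arguments sub_pred {F} S V : rename.

HB.instance Definition _ (F : Fun) (S : subfunctor F) V :=
  GRing.isZmodClosed.Build (F V) (sub_pred S V) (@sub_zmod_closed F S V).

Section Sub.
Variables (F : Fun) (S : subfunctor F).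

Definition sub_obj V : Type := {x : F V | x \in sub_pred S V}.

HB.instance Definition _ V := [isSub of sub_obj V for sval].
HB.instance Definition _ V := [Choice of sub_obj V by <:].
HB.instance Definition _ V := [SubChoice_isSubZmodule of sub_obj V by <:].

Definition sub_map U V (f : 'Hom(U, V)) (x : sub_obj U) :
  sub_obj V := Sub (fmap F f (val x)) (sub_stable f (valP x)).

Fact sub_map_is_zmod_morphism U V f : zmod_morphism (@sub_map U V f).
Proof. by move=> x y; apply: val_inj; rewrite raddfB !SubK !raddfB. Qed.

HB.instance Definition _ U V f :=
  GRing.isZmodMorphism.Build (sub_obj U) (sub_obj V)
    (@sub_map U V f) (@sub_map_is_zmod_morphism U V f).

Fact sub_map_id U x : sub_map (\1%VF : 'Hom(U, U)) x = x.
Proof. by apply: val_inj; rewrite SubK fmap_id. Qed.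

Fact sub_map_comp U V W (g : 'Hom(V, W)) (f : 'Hom(U, V)) x :
  sub_map (g \o f)%VF x = sub_map g (sub_map f x).
Proof. by apply: val_inj; rewrite !SubK fmap_comp. Qed.

Definition sub_fun : Fun :=
  @MkFun (fun V => sub_obj V) (fun U V f => @sub_map U V f)
    sub_map_id sub_map_comp.

Definition sub_incl : nat_trans sub_fun F :=
  @MkNat sub_fun F (fun V => val : sub_obj V -> F V) (fun _ _ _ _ => erefl).

Lemma sub_incl_in V (x : sub_fun V) : sub_incl V x \in sub_pred S V.
Proof. exact: valP. Qed.

End Sub.
Arguments sub_incl {F} S.

Section Quo.
Variables (F : Fun) (S : subfunctor F).

Definition quo_obj V : Type := Quotient.quot (sub_pred S V).

HB.instance Definition _ V := ZmodQuotient.on (quo_obj V).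

Fact quo_eqP V (x y : F V) :
  reflect (\pi_(quo_obj V) x = \pi_(quo_obj V) y) (x - y \in sub_pred S V).
Proof. by rewrite Quotient.idealrBE; apply: eqP. Qed.

Fact quo_repr V (x : F V) : repr (\pi_(quo_obj V) x) - x \in sub_pred S V.
Proof. by apply/quo_eqP; rewrite reprK. Qed.

Definition quo_map U V (f : 'Hom(U, V)) (x : quo_obj U) :
  quo_obj V := \pi_(quo_obj V) (fmap F f (repr x)).

Fact quo_map_pi U V (f : 'Hom(U, V)) (x : F U) :
  quo_map f (\pi_(quo_obj U) x) = \pi_(quo_obj V) (fmap F f x).
Proof. by apply/quo_eqP; rewrite -raddfB; apply/sub_stable/quo_repr. Qed.

Fact quo_map_is_zmod_morphism U V f : zmod_morphism (@quo_map U V f).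
Proof.
move=> x y; rewrite -[x]reprK -[y]reprK -(raddfB \pi_(quo_obj U)) !quo_map_pi.
by rewrite !raddfB.
Qed.

HB.instance Definition _ U V f :=
  GRing.isZmodMorphism.Build (quo_obj U) (quo_obj V)
    (@quo_map U V f) (@quo_map_is_zmod_morphism U V f).

Fact quo_map_id U x : quo_map (\1%VF : 'Hom(U, U)) x = x.
Proof. by rewrite -[x]reprK quo_map_pi fmap_id. Qed.

Fact quo_map_comp U V W (g : 'Hom(V, W)) (f : 'Hom(U, V)) x :
  quo_map (g \o f)%VF x = quo_map g (quo_map f x).
Proof. by rewrite -[x]reprK (quo_map_pi f (repr x)) !quo_map_pi fmap_comp. Qed.

Definition quo_fun : Fun :=
  @MkFun (fun V => quo_obj V) (fun U V f => @quo_map U V f) quo_map_id quo_map_comp.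

Definition quo_proj : nat_trans F quo_fun :=
  @MkNat F quo_fun (fun V => \pi_(quo_obj V))
    (fun U V f x => esym (quo_map_pi f x)).

End Quo.
Arguments quo_proj {F} S.

(* With e_0, ..., e_(n-1) the basis of V given by [v2r], the element t of
   [tpow d V] stands for
     \sum_i t i *: (e_(i 0) (x) ... (x) e_(i (d-1))) : V (x) ... (x) V;
   see [tens] and [tens_universal] below. *)
Definition tpow (d : nat) V : zmodType :=
  {ffun {ffun 'I_d -> 'I_(dim V)} -> int}.

Section TensorPower.
Variable d : nat.

(* [f2mx f] acts on row vectors: its row i holds the coordinates of f e_i. *)
Definition tpow_map U V (f : 'Hom(U, V)) (t : tpow d U) : tpow d V :=
  [ffun j : {ffun 'I_d -> 'I_(dim V)} =>
     \sum_i t i * \prod_(k < d) f2mx f (i k) (j k)].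

Fact tpow_map_is_zmod_morphism U V f : zmod_morphism (@tpow_map U V f).
Proof.
move=> x y; apply/ffunP=> j; rewrite !ffunE -sumrB.
by apply: eq_bigr => i _; rewrite !ffunE mulrBl.
Qed.

HB.instance Definition _ U V f :=
  GRing.isZmodMorphism.Build (tpow d U) (tpow d V)
    (@tpow_map U V f) (@tpow_map_is_zmod_morphism U V f).

Fact f2mx_id V : f2mx (\1%VF : 'Hom(V, V)) = 1%:M.
Proof.
rewrite /id_lfun unlock; apply/row_matrixP=> i.
by rewrite !rowE mul_rV_lin1 /= r2vK mulmx1.
Qed.

Fact v2r_lfun U V (f : 'Hom(U, V)) u : v2r (f u) = v2r u *m f2mx f.
Proof. by rewrite unlock /= r2vK. Qed.

Fact f2mx_comp U V W (g : 'Hom(V, W)) (f : 'Hom(U, V)) :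
  f2mx (g \o f)%VF = f2mx f *m f2mx g.
Proof.
rewrite /comp_lfun unlock; apply/row_matrixP=> i.
by rewrite !rowE mul_rV_lin1 /= !v2r_lfun r2vK mulmxA.
Qed.

Fact prod_delta (I : finType) (i j : {ffun 'I_d -> I}) :
  \prod_(k < d) ((i k == j k)%:R : int) = (i == j)%:R.
Proof.
case: eqP => [->|/eqP neq_ij]; first by rewrite big1 // => k _; rewrite eqxx.
have [k neq_k] : exists k, i k != j k.
  apply/existsP; apply: contraNT neq_ij; rewrite negb_exists => /forallP e.
  by apply/eqP/ffunP=> k; apply/eqP; have := e k; rewrite negbK.
by rewrite (bigD1 k) //= (negPf neq_k) mul0r.
Qed.

Fact sum_delta (I : finType) (t : I -> int) (j : I) :
  \sum_i t i * (i == j)%:R = t j.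
Proof.
rewrite (bigD1 j) //= eqxx mulr1 big1 ?addr0 // => i /negPf->.
by rewrite mulr0.
Qed.

Fact tpow_map_id V t : tpow_map (\1%VF : 'Hom(V, V)) t = t.
Proof.
apply/ffunP=> j; rewrite ffunE -[RHS]sum_delta; apply: eq_bigr => i _.
by rewrite -prod_delta; congr (_ * _); apply: eq_bigr => k _; rewrite f2mx_id mxE.
Qed.

Fact tpow_map_comp U V W (g : 'Hom(V, W)) (f : 'Hom(U, V)) t :
  tpow_map (g \o f)%VF t = tpow_map g (tpow_map f t).
Proof.
apply/ffunP=> l; rewrite !ffunE.
under [RHS]eq_bigr => j _ do rewrite ffunE mulr_suml.
rewrite exchange_big /=; apply: eq_bigr => i _.
under [RHS]eq_bigr => j _ do rewrite -mulrA -big_split /=.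
rewrite -mulr_sumr; congr (_ * _).
rewrite -(bigA_distr_bigA (fun k m => f2mx f (i k) m * f2mx g m (l k))).
by apply: eq_bigr => k _; rewrite f2mx_comp mxE.
Qed.

Definition Tensor : Fun :=
  @MkFun (tpow d) (fun U V f => @tpow_map U V f) tpow_map_id tpow_map_comp.

(* The pure tensor v_0 (x) ... (x) v_(d-1). *)
Definition tens V (v : {ffun 'I_d -> V}) : tpow d V :=
  [ffun i : {ffun 'I_d -> 'I_(dim V)} => \prod_(k < d) v2r (v k) 0 (i k)].

Definition upd (T : Type) (v : {ffun 'I_d -> T}) (k : 'I_d) (x : T) :=
  [ffun l => if l == k then x else v l].

Definition multi_additive V (A : zmodType) (m : {ffun 'I_d -> V} -> A) :=
  forall v k, {morph (fun x => m (upd v k x)) : x y / x + y}.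

Lemma tpow_map_tens U V (f : 'Hom(U, V)) (v : {ffun 'I_d -> U}) :
  tpow_map f (tens v) = tens [ffun k => f (v k)].
Proof.
apply/ffunP=> j; rewrite !ffunE.
transitivity (\prod_k \sum_m v2r (v k) 0 m * f2mx f m (j k)).
  rewrite bigA_distr_bigA; apply: eq_bigr => i _.
  by rewrite ffunE -big_split.
by apply: eq_bigr => k _; rewrite ffunE v2r_lfun mxE.
Qed.

Lemma tens_multi_additive V : multi_additive (@tens V).
Proof.
move=> v k x y; apply/ffunP=> i; rewrite !ffunE !(bigD1 k (P := predT)) //=.
rewrite !ffunE eqxx raddfD mxE mulrDl; congr (_ * _ + _ * _);
  by apply: eq_bigr => l /negPf lk; rewrite !ffunE lk.
Qed.

Definition bvec V (i : 'I_(dim V)) : V := r2v (delta_mx 0 i).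

Fact bvec_sum V (v : V) : v = \sum_i bvec i *~ v2r v 0 i.
Proof.
rewrite -[LHS]v2rK [in LHS](row_sum_delta (v2r v)) linear_sum.
by apply: eq_bigr => i _; rewrite linearZ /= -{1}[v2r v 0 i]intz scaler_int.
Qed.

Fact multi_additive_ext V (A : zmodType) (m m' : {ffun 'I_d -> V} -> A) :
    multi_additive m -> multi_additive m' ->
    (forall i : {ffun 'I_d -> 'I_(dim V)},
       m [ffun k => bvec (i k)] = m' [ffun k => bvec (i k)]) ->
  m =1 m'.
Proof.
move=> addm addm' eqm.
suff gen n : (n <= d)%N -> forall v : {ffun 'I_d -> V},
    (forall k : 'I_d, (n <= k)%N -> exists i, v k = bvec i) -> m v = m' v.
  by move=> v; apply: (gen d) => // k; rewrite leqNgt ltn_ord.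
elim: n => [_ v hv | n IHn ltnd v hv].
  have /fin_all_exists [i hi] k : exists i, v k = bvec i by apply: hv.
  have -> : v = [ffun k => bvec ([ffun k => i k] k)].
    by apply/ffunP=> k; rewrite !ffunE.
  exact: eqm.
pose k0 := Ordinal ltnd.
have updE : v = upd v k0 (v k0).
  by apply/ffunP=> l; rewrite ffunE; case: eqP => [->|].
have exp (q : {ffun 'I_d -> V} -> A) : multi_additive q ->
    q v = \sum_i q (upd v k0 (bvec i)) *~ v2r (v k0) 0 i.
  move=> addq; have q0 : q (upd v k0 0) = 0.
    by apply: (addrI (q (upd v k0 0))); rewrite -addq !addr0.
  have qB : zmod_morphism (fun x => q (upd v k0 x)).
    move=> x y; apply: (addIr (q (upd v k0 y))).
    by rewrite -addq !subrK.
  pose qa := GRing.isZmodMorphism.Build V A _ qB.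
  pose qA : {additive V -> A} := HB.pack (fun x => q (upd v k0 x)) qa.
  rewrite [in LHS]updE -[LHS]/(qA (v k0)) [in LHS](bvec_sum (v k0)) raddf_sum.
  by apply: eq_bigr => i _; rewrite raddfMz.
rewrite !exp //; apply: eq_bigr => i _; congr (_ *~ _); apply: IHn => [|k].
  exact: ltnW.
rewrite leq_eqVlt ffunE => /orP[/eqP nk | ltnk].
  have -> : k == k0 by rewrite -val_eqE /= -nk eqxx.
  by exists i.
case: eqP => _; [by exists i | exact: hv].
Qed.

Fact tens_bvec V (i : {ffun 'I_d -> 'I_(dim V)}) :
  tens [ffun k => bvec (i k)] = [ffun j => (i == j)%:R].
Proof.
apply/ffunP=> j; rewrite !ffunE -prod_delta; apply: eq_bigr => k _.
by rewrite ffunE /bvec r2vK mxE eqxx eq_sym.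
Qed.

Fact tpowMzE V (t : tpow d V) (c : int) j : (t *~ c) j = t j *~ c.
Proof. by case: c => n; rewrite /intmul ?ffunE ffunMnE. Qed.

Lemma tens_universal V (A : zmodType) (m : {ffun 'I_d -> V} -> A) :
  multi_additive m ->
  exists2 h : {additive tpow d V -> A}, (forall v, h (tens v) = m v) &
    forall h' : {additive tpow d V -> A}, (forall v, h' (tens v) = m v) ->
      h' =1 h.
Proof.
move=> addm.
pose h (t : tpow d V) := \sum_(i : {ffun 'I_d -> 'I_(dim V)}) m [ffun k => bvec (i k)] *~ t i.
have hB : zmod_morphism h.
  move=> s t; rewrite /h -sumrB; apply: eq_bigr => i _.
  by rewrite !ffunE mulrzBr.
pose ha := GRing.isZmodMorphism.Build (tpow d V) A _ hB.
pose hA : {additive tpow d V -> A} := HB.pack h ha.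
exists hA.
  apply: multi_additive_ext => // [v k x y|i].
    by rewrite tens_multi_additive raddfD.
  rewrite tens_bvec /= /h (bigD1 i) //= ffunE eqxx big1 ?addr0 // => j.
  by rewrite ffunE eq_sym => /negPf->.
move=> h' h'E t.
have -> : t = \sum_(i : {ffun 'I_d -> 'I_(dim V)}) tens [ffun k => bvec (i k)] *~ t i.
  apply/ffunP=> j; rewrite sum_ffunE -[LHS]sum_delta; apply: eq_bigr => i _.
  by rewrite tens_bvec tpowMzE ffunE -mulrzl intz.
rewrite !raddf_sum; apply: eq_bigr => i _; rewrite !raddfMz h'E.
congr (_ *~ _); symmetry; rewrite /= tens_bvec /h (bigD1 i) //= ffunE eqxx.
by rewrite big1 ?addr0 // => j; rewrite ffunE eq_sym => /negPf->.
Qed.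

Definition tperm_act V (s : 'S_d) (t : tpow d V) : tpow d V :=
  [ffun i : {ffun 'I_d -> 'I_(dim V)} => t [ffun k => i (s k)]].

Fact tperm_act_is_zmod_morphism V s : zmod_morphism (@tperm_act V s).
Proof. by move=> x y; apply/ffunP=> i; rewrite !ffunE. Qed.

HB.instance Definition _ V s :=
  GRing.isZmodMorphism.Build (tpow d V) (tpow d V)
    (@tperm_act V s) (@tperm_act_is_zmod_morphism V s).

Lemma tperm_act_tens V s (v : {ffun 'I_d -> V}) :
  tperm_act s (tens v) = tens [ffun k => v ((s^-1)%g k)].
Proof.
apply/ffunP=> i; rewrite !ffunE [RHS](reindex_inj (@perm_inj _ s)) /=.
by apply: eq_bigr => k _; rewrite !ffunE permK.
Qed.

Fact tpow_map_act U V (f : 'Hom(U, V)) s t :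
  tpow_map f (tperm_act s t) = tperm_act s (tpow_map f t).
Proof.
apply/ffunP=> j; rewrite !ffunE.
pose r (i : {ffun 'I_d -> 'I_(dim U)}) := [ffun k => i ((s^-1)%g k)].
have r_inj : injective r.
  move=> i i' /ffunP e; apply/ffunP=> k; have := e (s k).
  by rewrite !ffunE permK.
rewrite (reindex_inj r_inj) /=; apply: eq_bigr => i _; rewrite ffunE.
congr (t _ * _); first by apply/ffunP=> k; rewrite !ffunE permK.
rewrite (reindex_inj (@perm_inj _ s)) /=; apply: eq_bigr => k _.
by rewrite !ffunE permK.
Qed.

(* For V free, the divided power Gamma^d V is the group of symmetric tensors
   (V (x) ... (x) V)^(S_d); the action is described by [tperm_act_tens]. *)
Definition inv_pred V : {pred tpow d V} :=
  [pred t | [forall s : 'S_d, tperm_act s t == t]].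

Fact inv_zmod_closed V : zmod_closed (@inv_pred V).
Proof.
split=> [|x y]; rewrite !inE.
  by apply/forallP=> s; rewrite raddf0.
move=> /forallP hx /forallP hy; apply/forallP=> s.
by rewrite raddfB /= (eqP (hx s)) (eqP (hy s)).
Qed.

Fact inv_stable U V (f : 'Hom(U, V)) (t : tpow d U) :
  t \in @inv_pred U -> tpow_map f t \in @inv_pred V.
Proof.
rewrite !inE => /forallP ht; apply/forallP=> s.
by rewrite -tpow_map_act (eqP (ht s)).
Qed.

Definition inv_sub : subfunctor Tensor :=
  @MkSub Tensor inv_pred inv_zmod_closed inv_stable.

Definition Gamma : Fun := sub_fun inv_sub.

(* The symmetric power is the group of coinvariants (V (x) ... (x) V)_(S_d).
   As t |-> t - s t is additive for each s, these sums form the subgroup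
   generated by all the elements t - s t. *)
Definition coinv_pred V : {pred tpow d V} :=
  [pred t | `[< exists c : 'S_d -> tpow d V,
                  t = \sum_s (c s - tperm_act s (c s)) >]].

Fact coinv_zmod_closed V : zmod_closed (@coinv_pred V).
Proof.
split=> [|x y]; rewrite !inE.
  by apply/asboolP; exists (fun=> 0); rewrite big1 // => s _; rewrite raddf0 subr0.
move=> /asboolP[a ->] /asboolP[b ->]; apply/asboolP.
exists (fun s => a s - b s); rewrite -sumrB; apply: eq_bigr => s _.
by rewrite (raddfB (@tperm_act V s)) /= !opprD !opprK addrACA.
Qed.

Fact coinv_stable U V (f : 'Hom(U, V)) (t : tpow d U) :
  t \in @coinv_pred U -> tpow_map f t \in @coinv_pred V.
Proof.
rewrite !inE => /asboolP[c ->]; apply/asboolP.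
exists (fun s => tpow_map f (c s)); rewrite raddf_sum; apply: eq_bigr => s _.
by rewrite raddfB /= tpow_map_act.
Qed.

Definition coinv_sub : subfunctor Tensor :=
  @MkSub Tensor coinv_pred coinv_zmod_closed coinv_stable.

Definition Sym : Fun := quo_fun coinv_sub.

End TensorPower.

(* Yoneda extensions 0 -> G -> E -> F -> 0; exactness in Fun is objectwise. *)
Record extension (F G : Fun) := MkExt {
  ext_mid : Fun;
  ext_in : nat_trans G ext_mid;
  ext_out : nat_trans ext_mid F;
  ext_in_inj : forall V, injective (ext_in V);
  ext_out_surj : forall V (y : F V), exists x, ext_out V x = y;
  ext_exact : forall V (x : ext_mid V),
    ext_out V x = 0 <-> exists a, x = ext_in V a
}.

(* By the five lemma such an h is invertible. *)
Definition ext_equiv (F G : Fun) (E E' : extension F G) : Prop :=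
  exists h : nat_trans (ext_mid E) (ext_mid E'),
    (forall V a, h V (ext_in E V a) = ext_in E' V a) /\
    (forall V x, ext_out E' V (h V x) = ext_out E V x).

Section Baer.
Variables (F G : Fun) (E1 E2 : extension F G).

(* The middle term is (E1 x_F E2) / {(a, - a) | a in G}. *)
Definition pb_pred V : {pred dsum (ext_mid E1) (ext_mid E2) V} :=
  [pred x | ext_out E1 V x.1 == ext_out E2 V x.2].

Fact pb_zmod_closed V : zmod_closed (@pb_pred V).
Proof.
split=> [|x y]; rewrite !inE; first by rewrite !raddf0.
by move=> /eqP hx /eqP hy; rewrite !raddfB hx hy.
Qed.

Fact pb_stable U V (f : 'Hom(U, V)) (x : dsum (ext_mid E1) (ext_mid E2) U) :
  x \in @pb_pred U -> fmap (dsum (ext_mid E1) (ext_mid E2)) f x \in @pb_pred V.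
Proof. by rewrite !inE => /eqP hx; rewrite /= !nt_natural hx. Qed.

Definition pb_sub := @MkSub (dsum (ext_mid E1) (ext_mid E2)) pb_pred
  pb_zmod_closed pb_stable.

Definition pullback : Fun := sub_fun pb_sub.

Definition adiag_pred V : {pred pullback V} :=
  [pred x | `[< exists a, sub_incl pb_sub V x = (ext_in E1 V a, - ext_in E2 V a) >]].

Fact adiag_zmod_closed V : zmod_closed (@adiag_pred V).
Proof.
split=> [|x y]; rewrite !inE.
  by apply/asboolP; exists 0; rewrite !raddf0.
move=> /asboolP[a ha] /asboolP[b hb]; apply/asboolP.
by exists (a - b); rewrite [LHS]raddfB ha hb dsumB /= !raddfB.
Qed.

Fact adiag_stable U V (f : 'Hom(U, V)) (x : pullback U) :
  x \in @adiag_pred U -> fmap pullback f x \in @adiag_pred V.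
Proof.
rewrite !inE => /asboolP[a ha]; apply/asboolP; exists (fmap G f a).
rewrite [LHS]nt_natural ha /= /dsum_map /= raddfN.
by rewrite !nt_natural.
Qed.

Definition adiag_sub :=
  @MkSub pullback adiag_pred adiag_zmod_closed adiag_stable.

Definition baer_mid : Fun := quo_fun adiag_sub.

Definition pb_fst V (x : pullback V) : ext_mid E1 V := (sub_incl pb_sub V x).1.
Definition pb_snd V (x : pullback V) : ext_mid E2 V := (sub_incl pb_sub V x).2.

Fact pb_pair V x1 x2 : ext_out E1 V x1 = ext_out E2 V x2 ->
  exists2 x : pullback V, pb_fst x = x1 & pb_snd x = x2.
Proof.
move=> e; have pbx : (x1, x2) \in sub_pred pb_sub V by rewrite inE /= e.
by exists (exist _ (x1, x2) pbx).
Qed.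

Fact pb_eq V (x : pullback V) : ext_out E1 V (pb_fst x) = ext_out E2 V (pb_snd x).
Proof. by have := sub_incl_in x; rewrite inE => /eqP. Qed.

Fact pb_inj V (x y : pullback V) :
  pb_fst x = pb_fst y -> pb_snd x = pb_snd y -> x = y.
Proof.
move=> e1 e2; apply: val_inj.
by rewrite [LHS]surjective_pairing [RHS]surjective_pairing; congr (_, _).
Qed.

Fact pb_fstB V : zmod_morphism (@pb_fst V).
Proof. by move=> x y; rewrite /pb_fst raddfB. Qed.

Fact pb_sndB V : zmod_morphism (@pb_snd V).
Proof. by move=> x y; rewrite /pb_snd raddfB. Qed.

Fact baer_eqP V (x y : pullback V) :
  quo_proj adiag_sub V x = quo_proj adiag_sub V y <->
  exists a, pb_fst x - pb_fst y = ext_in E1 V a /\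
            pb_snd x - pb_snd y = - ext_in E2 V a.
Proof.
split=> [/quo_eqP|[a [e1 e2]]].
  rewrite inE => /asboolP[a e]; exists a.
  by rewrite -pb_fstB -pb_sndB /pb_fst /pb_snd e.
apply/quo_eqP; rewrite inE; apply/asboolP; exists a.
by rewrite [LHS]surjective_pairing; congr (_, _);
  rewrite -?[LHS]/(pb_fst _) -?[LHS]/(pb_snd _) ?pb_fstB ?pb_sndB.
Qed.

Fact ext_out_in (E : extension F G) V a : ext_out E V (ext_in E V a) = 0.
Proof. by apply/ext_exact; exists a. Qed.

Fact baer_in_subproof V (a : G V) : (ext_in E1 V a, 0) \in sub_pred pb_sub V.
Proof. by rewrite inE /= raddf0 ext_out_in. Qed.

Definition baer_in_fun V (a : G V) : baer_mid V :=
  quo_proj adiag_sub V (exist _ (ext_in E1 V a, 0) (baer_in_subproof a)).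

Fact baer_in_is_zmod_morphism V : zmod_morphism (@baer_in_fun V).
Proof.
move=> a b; rewrite /baer_in_fun -[RHS]raddfB; congr (quo_proj _ _ _).
apply: pb_inj; rewrite ?pb_fstB ?pb_sndB /pb_fst /pb_snd /= ?subr0 //.
by rewrite raddfB.
Qed.

HB.instance Definition _ V := GRing.isZmodMorphism.Build (G V) (baer_mid V)
  (@baer_in_fun V) (@baer_in_is_zmod_morphism V).

Fact baer_in_natural U V (f : 'Hom(U, V)) (a : G U) :
  baer_in_fun (fmap G f a) = fmap baer_mid f (baer_in_fun a).
Proof.
rewrite /baer_in_fun -nt_natural; congr (quo_proj _ _ _).
by apply: pb_inj; rewrite /pb_fst /pb_snd /= ?raddf0 ?nt_natural.
Qed.

Definition baer_in : nat_trans G baer_mid :=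
  @MkNat G baer_mid (fun V => @baer_in_fun V) baer_in_natural.

Definition baer_out_fun V (x : baer_mid V) : F V :=
  ext_out E1 V (pb_fst (repr (x : quo_obj adiag_sub V))).

Fact baer_out_proj V (x : pullback V) :
  baer_out_fun (quo_proj adiag_sub V x) = ext_out E1 V (pb_fst x).
Proof.
apply/eqP; rewrite -subr_eq0 -raddfB.
have [|a [-> _]] := (baer_eqP (repr (\pi_(quo_obj adiag_sub V) x)) x).1.
  exact: reprK.
by rewrite ext_out_in.
Qed.

Fact quo_proj_surj V (x : baer_mid V) : exists y, x = quo_proj adiag_sub V y.
Proof. by exists (repr (x : quo_obj adiag_sub V)); rewrite /= reprK. Qed.

Fact baer_out_is_zmod_morphism V : zmod_morphism (@baer_out_fun V).
Proof.
move=> x y; have [x' ->] := quo_proj_surj x; have [y' ->] := quo_proj_surj y.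
by rewrite -raddfB !baer_out_proj pb_fstB raddfB.
Qed.

HB.instance Definition _ V := GRing.isZmodMorphism.Build (baer_mid V) (F V)
  (@baer_out_fun V) (@baer_out_is_zmod_morphism V).

Fact baer_out_natural U V (f : 'Hom(U, V)) (x : baer_mid U) :
  baer_out_fun (fmap baer_mid f x) = fmap F f (baer_out_fun x).
Proof.
have [y ->] := quo_proj_surj x; rewrite -nt_natural !baer_out_proj -nt_natural.
by rewrite /pb_fst nt_natural.
Qed.

Definition baer_out : nat_trans baer_mid F :=
  @MkNat baer_mid F (fun V => @baer_out_fun V) baer_out_natural.

Fact baer_in_inj V : injective (baer_in V).
Proof.
move=> a b /baer_eqP[c []]; rewrite /pb_fst /pb_snd /= subr0 -raddfB => e1 e2.
have c0 : c = 0.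
  by apply: (ext_in_inj (e := E2)); apply: oppr_inj; rewrite -e2 raddf0 oppr0.
by apply/eqP; rewrite -subr_eq0; apply/eqP/(ext_in_inj (e := E1)); rewrite e1 c0.
Qed.

Fact baer_out_surj V (y : F V) : exists x, baer_out V x = y.
Proof.
have [x1 e1] := ext_out_surj E1 y; have [x2 e2] := ext_out_surj E2 y.
have [x ex _] := pb_pair (etrans e1 (esym e2)).
by exists (quo_proj adiag_sub V x); rewrite [LHS]baer_out_proj ex.
Qed.

Fact baer_exact V (x : baer_mid V) :
  baer_out V x = 0 <-> exists a, x = baer_in V a.
Proof.
split=> [|[a ->]]; last by rewrite [LHS]baer_out_proj ext_out_in.
have [r ->] := quo_proj_surj x; rewrite [baer_out V _]baer_out_proj => r1.
have r2 := r1; rewrite pb_eq in r2.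
have [a1 e1] := (ext_exact _).1 r1; have [a2 e2] := (ext_exact _).1 r2.
exists (a1 + a2); apply/baer_eqP; exists (- a2).
rewrite e1 e2 /pb_fst /pb_snd /= subr0 raddfD !raddfN opprK opprD addrA subrr.
by rewrite add0r.
Qed.

Definition baer_sum : extension F G :=
  @MkExt F G baer_mid baer_in baer_out baer_in_inj baer_out_surj baer_exact.

End Baer.

(* Ext^1(F, G) is the group of classes of extensions of F by G modulo
   [ext_equiv], with addition induced by [baer_sum].  The extensions are too
   large for their classes to be a [zmodType], so an isomorphism from
   Ext^1(F, G) to A is given as a function on extensions. *)
Definition Ext1_isog (F G : Fun) (A : zmodType) : Prop :=
  exists phi : extension F G -> A,
    [/\ forall E E', phi E = phi E' <-> ext_equiv E E',
        forall a, exists E, phi E = a &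
        forall E E', phi (baer_sum E E') = phi E + phi E'].

(* Main.v *)
(* The invariant of an extension E measures how far a lift y in E(Z^2) of
   gamma_3(e_0) e_1 is from being additive in e_1: the element
   y(e_0, e_1 + e_2) - y(e_0, e_1) - y(e_0, e_2) lies in S^4(Z^3), and replacing y
   by y + s with s = \sum_i b_i e_0^(4-i) e_1^i changes its coefficients at
   e_0^2 e_1 e_2 and e_0 e_1^2 e_2 by 2 b_2 and 3 b_3.  They are therefore well
   defined in Z/2 and Z/3.

   Injectivity.  The norm T^4 -> Gamma^4 lifts to E, because T^4 is projective
   among functors of degree at most 4.  The lift, restricted to Gamma^4, covers
   multiplication by 4! = 24, which gives r : E -> S^4 equal to 24 on S^4.
   Then E is the pullback of S^4 -> S^4/24 along the map Gamma^4 -> S^4/24 induced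
   by r.  As Gamma^4 is generated by the elements gamma_4(v) and gamma_3(v) w, that
   map is determined by its values on gamma_4(e_0) and gamma_3(e_0) e_1, and up to
   a multiple of the canonical map these depend only on the invariant.

   Surjectivity.  Pull back S^4 -> S^4/6 along combinations of the natural maps
   gamma_2(u) v w |-> u v^2 w to S^4/2 and gamma_3(u) v |-> u v^3 to S^4/3, which
   are additive in each variable by Frobenius. *)

From HB Require Import structures.
From mathcomp Require Import fingroup perm all_boot all_algebra.
From mathcomp Require Import boolp ring zify.
From mathcomp Require Import mpoly.
Require Import Defs.

Set Implicit Arguments.
Unset Strict Implicit.
Unset Printing Implicit Defensive.
Import GRing.Theory VectorInternalTheory.
Local Open Scope ring_scope.
Local Open Scope quotient_scope.

(** * Homomorphisms out of Z^n *)

(* Unlike that of ['rV[int]_n], which is [1 * n], the dimension of [Zn n] is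
   convertible to [n]. *)
Definition Zn (n : nat) : Type := 'rV[int]_n.
HB.instance Definition _ n := GRing.Lmodule.on (Zn n).
Fact Zn_axiom n : Vector.axiom n (Zn n).
Proof. by exists id; [move=> a u v | exists id]. Qed.
HB.instance Definition _ n := Lmodule_hasFinDim.Build int (Zn n) (Zn_axiom n).

Definition basis n (i : 'I_n) : Zn n := bvec (i : 'I_(dim (Zn n))).

Definition hom_of n (V : vectType int) (v : 'I_n -> V) : 'Hom(Zn n, V) :=
  Hom ((\matrix_(i < n) v2r (v i)) : 'M_(dim (Zn n), dim V)).

Lemma hom_of_basis n (V : vectType int) (v : 'I_n -> V) i : hom_of v (basis i) = v i.
Proof. by apply: v2r_inj; rewrite v2r_lfun /basis /bvec r2vK -rowE rowK. Qed.

Lemma row_f2mx (U V : vectType int) (f : 'Hom(U, V)) i :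
  row i (f2mx f) = v2r (f (bvec i)).
Proof. by rewrite v2r_lfun /bvec r2vK rowE. Qed.

Lemma comp_hom_of n (U V : vectType int) (f : 'Hom(U, V)) (v : 'I_n -> U) :
  (f \o hom_of v)%VF = hom_of (f \o v).
Proof.
apply: val_inj; apply/row_matrixP => i /=; rewrite [LHS]row_f2mx rowK comp_lfunE.
by rewrite (hom_of_basis v i).
Qed.

(** * Symmetric powers as homogeneous polynomials *)

Section Evaluation.
Variables (d : nat) (R : comNzRingType).
Implicit Types U V : vectType int.

(** This is multiplication after e_i |-> x i. It factors through the coinvariants, and for x the
    variables of a polynomial ring it turns Sym^d into forms of degree d. *)
Definition eval_tensor V (x : 'I_(dim V) -> R) (t : tpow d V) : R :=
  \sum_(j : {ffun 'I_d -> 'I_(dim V)}) (t j)%:~R * \prod_(k < d) x (j k).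

Fact eval_tensor_is_zmod_morphism V (x : 'I_(dim V) -> R) : zmod_morphism (eval_tensor x).
Proof.
by move=> s t; rewrite /eval_tensor -sumrB; apply: eq_bigr => j _; rewrite !ffunE rmorphB mulrBl.
Qed.

HB.instance Definition _ V x :=
  GRing.isZmodMorphism.Build (tpow d V) R (@eval_tensor V x) (eval_tensor_is_zmod_morphism x).

Lemma eval_tensor_act V (x : 'I_(dim V) -> R) s t : eval_tensor x (tperm_act s t) = eval_tensor x t.
Proof.
rewrite /eval_tensor.
pose r (i : {ffun 'I_d -> 'I_(dim V)}) := [ffun k => i ((s^-1)%g k)].
have r_inj : injective r.
  move=> i i' /ffunP E; apply/ffunP=> k; have := E (s k).
  by rewrite !ffunE permK.
rewrite (reindex_inj r_inj) /=; apply: eq_bigr => i _; rewrite ffunE.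
congr ((t _)%:~R * _); first by apply/ffunP=> k; rewrite !ffunE permK.
rewrite (reindex_inj (@perm_inj _ s)) /=; apply: eq_bigr => k _.
by rewrite !ffunE permK.
Qed.

Definition lin_eval V (x : 'I_(dim V) -> R) (v : V) : R :=
  \sum_i (v2r v 0 i)%:~R * x i.

Lemma eval_tensor_tens V (x : 'I_(dim V) -> R) (v : {ffun 'I_d -> V}) :
  eval_tensor x (tens v) = \prod_(k < d) lin_eval x (v k).
Proof.
rewrite /lin_eval bigA_distr_bigA; apply: eq_bigr => i _.
by rewrite ffunE rmorph_prod -big_split.
Qed.

Definition pull_coords (U V : vectType int) (f : 'Hom(U, V))
  (x : 'I_(dim V) -> R) (i : 'I_(dim U)) : R :=
  lin_eval x (f (bvec i)).

Lemma eval_tensor_map U V (f : 'Hom(U, V)) (x : 'I_(dim V) -> R) t :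
  eval_tensor x (tpow_map f t) = eval_tensor (pull_coords f x) t.
Proof.
rewrite {1}/eval_tensor; under eq_bigr => j _ do rewrite ffunE rmorph_sum mulr_suml.
rewrite exchange_big; apply: eq_bigr => i _ /=.
under eq_bigr => j _ do rewrite rmorphM /= -mulrA rmorph_prod -big_split /=.
rewrite -mulr_sumr; congr (_ * _).
rewrite -(bigA_distr_bigA (fun k m => (f2mx f (i k) m)%:~R * x m)).
apply: eq_bigr => k _; apply: eq_bigr => m _.
by rewrite -row_f2mx mxE.
Qed.

Definition sym_class V : tpow d V -> Sym d V := quo_proj (coinv_sub d) V.

Definition eval_sym V (x : 'I_(dim V) -> R) (s : Sym d V) : R :=
  eval_tensor x (generic_quotient.repr (s : quo_obj (coinv_sub d) V)).

Lemma eval_tensor_coinv V (x : 'I_(dim V) -> R) t :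
  t \in sub_pred (coinv_sub d) V -> eval_tensor x t = 0.
Proof.
move=> /asboolP[c ->]; rewrite raddf_sum big1 //= => s _.
by rewrite raddfB /= eval_tensor_act subrr.
Qed.

Lemma eval_sym_class V (x : 'I_(dim V) -> R) t : eval_sym x (sym_class t) = eval_tensor x t.
Proof.
apply/eqP; rewrite -subr_eq0 /eval_sym -(raddfB (eval_tensor x)).
exact/eqP/eval_tensor_coinv/quo_repr.
Qed.

Lemma sym_class_surj V (s : Sym d V) : exists t, s = sym_class t.
Proof.
by exists (generic_quotient.repr (s : quo_obj (coinv_sub d) V)); rewrite /sym_class /= reprK.
Qed.

HB.instance Definition _ V :=
  GRing.isZmodMorphism.Build (tpow d V) (Sym d V) (@sym_class V)
    (raddfB (quo_proj (coinv_sub d) V)).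

Fact eval_sym_is_zmod_morphism V (x : 'I_(dim V) -> R) : zmod_morphism (eval_sym x).
Proof.
move=> s t; have [s' ->] := sym_class_surj s; have [t' ->] := sym_class_surj t.
by rewrite -raddfB !eval_sym_class raddfB.
Qed.

HB.instance Definition _ V x :=
  GRing.isZmodMorphism.Build (Sym d V) R (@eval_sym V x) (eval_sym_is_zmod_morphism x).

Lemma fmap_sym_class U V (f : 'Hom(U, V)) t :
  fmap (Sym d) f (sym_class t) = sym_class (tpow_map f t).
Proof. exact: quo_map_pi. Qed.

Lemma eval_sym_map U V (f : 'Hom(U, V)) (x : 'I_(dim V) -> R) s :
  eval_sym x (fmap (Sym d) f s) = eval_sym (pull_coords f x) s.
Proof.
by have [t ->] := sym_class_surj s; rewrite fmap_sym_class !eval_sym_class eval_tensor_map.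
Qed.

Lemma sym_class_act V (t : tpow d V) s : sym_class (tperm_act s t) = sym_class t.
Proof.
apply/esym/quo_eqP; apply/asboolP.
exists (fun s' => if s' == s then t else 0).
rewrite (bigD1 s) //= eqxx big1 ?addr0 // => s' /negPf ->.
by rewrite raddf0 subr0.
Qed.

End Evaluation.
Arguments sym_class {d V} t.

(** * Monomial coordinates and divisibility in symmetric powers *)

Section Monomials.
Variables (d : nat) (V : vectType int).
Local Notation n := (dim V).
Implicit Types i j : {ffun 'I_d -> 'I_n}.

Definition content j : 'X_{1..n} := (\sum_(k < d) U_(j k))%MM.

Lemma contentE j a : content j a = count_mem a (codom j).
Proof.
rewrite mnm_sumE codomE count_map -sum1_count big_enum_cond /= [RHS]big_mkcond.
by apply: eq_bigr => k _; rewrite mnm1E; case: eqP.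
Qed.

(** Equal exponents mean that i and j, read as words, contain each letter equally often, so one word
    is a rearrangement of the other. Monomials thus label the S_d-orbits of index tuples. *)
Lemma content_perm i j : content i = content j -> exists s : 'S_d, j = [ffun k => i (s k)].
Proof.
move=> eqij.
have : perm_eq [tuple i k | k < d] [tuple j k | k < d].
  apply/allP => a _; apply/eqP; have := congr1 (fun m : 'X_{1..n} => m a) eqij.
  by rewrite !contentE !codomE /=.
rewrite perm_sym => /tuple_permP[s /eqP]; rewrite -[X in X == _]/(tval _).
move=> /eqP /val_inj E; exists s; apply/ffunP => k; rewrite ffunE.
by have := congr1 (fun t => tnth t k) E; rewrite !tnth_mktuple => ->.
Qed.

(** A representative of the S_d-orbit of i that depends only on [content i], so that sums over
    orbits can be written as sums over its fixed points. *)
Definition content_repr i := odflt i [pick j | content j == content i].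

Lemma content_reprK i : content (content_repr i) = content i.
Proof. by rewrite /content_repr; case: pickP => //= j /eqP. Qed.

Lemma eq_content_repr i j : (content_repr i == content_repr j) = (content i == content j).
Proof.
apply/eqP/eqP => [E|E]; first by rewrite -content_reprK E content_reprK.
by rewrite /content_repr E; case: pickP => //= /(_ j); rewrite eqxx.
Qed.

Lemma content_repr_id i : content_repr (content_repr i) = content_repr i.
Proof. by apply/eqP; rewrite eq_content_repr content_reprK. Qed.

Definition tdelta i : tpow d V := [ffun j => (i == j)%:R].

Lemma tpow_sum (t : tpow d V) : t = \sum_i tdelta i *~ t i.
Proof.
apply/ffunP=> j; rewrite sum_ffunE -[LHS]sum_delta; apply: eq_bigr => i _.
by rewrite tpowMzE ffunE -mulrzl intz.
Qed.

Lemma sym_class_repr i : sym_class (tdelta (content_repr i)) = sym_class (tdelta i).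
Proof.
have [s] := content_perm (content_reprK i); move: (content_repr i) => c ->.
rewrite -(sym_class_act (tdelta c) (s^-1)%g); congr (sym_class _); apply/ffunP => j.
rewrite !ffunE; congr (nat_of_bool _)%:R; apply/eqP/eqP=> [->|<-].
  by apply/ffunP => k; rewrite !ffunE permK.
by apply/ffunP => k; rewrite !ffunE permKV.
Qed.

Definition genX (R : comNzRingType) (i : 'I_n) : {mpoly R[n]} := 'X_i.

Definition content_sum (m : 'X_{1..n}) (t : tpow d V) : int :=
  \sum_(j : {ffun 'I_d -> 'I_n} | content j == m) t j.

Lemma mcoeff_eval_tensor (R : comNzRingType) (m : 'X_{1..n}) (t : tpow d V) :
  (eval_tensor (genX R) t)@_m = (content_sum m t)%:~R.
Proof.
rewrite /eval_tensor /content_sum /genX raddf_sum rmorph_sum [RHS]big_mkcond.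
apply: eq_bigr => j _ /=.
rewrite mprodXE -/(content j) mulrzl raddfMz /= mcoeffX.
by case: eqP => _; rewrite ?mul0rz.
Qed.

(** In the coinvariants, basis tensors of equal content coincide. Collecting them writes the class
    of t with one generator per content m, whose coefficient is [content_sum m t]. *)
Lemma sym_class_div N (t : tpow d V) :
  (forall m, exists z, content_sum m t = z *+ N) -> exists s, sym_class t = s *+ N.
Proof.
move=> H; pose z m := projT1 (cid (H m)).
have zE m : content_sum m t = z m *+ N := projT2 (cid (H m)).
exists (\sum_(i | content_repr i == i) sym_class (tdelta i) *~ z (content i)).
rewrite {1}[t]tpow_sum raddf_sum -sumrMnl.
transitivity (\sum_i sym_class (tdelta (content_repr i)) *~ t i).
  by apply: eq_bigr => i _; rewrite sym_class_repr -raddfMz.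
rewrite (partition_big content_repr (fun i => content_repr i == i)) => [|i _];
  last by rewrite content_repr_id.
apply: eq_bigr => i /eqP ci; under eq_bigr => j /eqP -> do [].
rewrite -mulrz_sumr.
have -> : \sum_(j | content_repr j == i) t j = content_sum (content i) t.
  by apply: eq_bigl => j; rewrite -{1}ci eq_content_repr.
by rewrite zE -mulr_natr natz mulrzA.
Qed.
End Monomials.

(* For [N = 0] this is injectivity. *)
Lemma eval_sym_div d (V : vectType int) N (s : Sym d V) q :
  eval_sym (@genX V int) s = q *+ N -> exists s', s = s' *+ N.
Proof.
have [t ->] := sym_class_surj s; rewrite eval_sym_class => H; apply: sym_class_div => m.
by exists (q@_m); rewrite -mcoeffMn -H mcoeff_eval_tensor intz.
Qed.

(** The coefficients over F_p are the residues of the [content_sum]s, so their vanishing is exactly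
    the divisibility that [sym_class_div] requires. *)
Lemma eval_sym_divp d (V : vectType int) p (s : Sym d V) : prime p ->
  eval_sym (@genX V 'F_p) s = 0 -> exists s', s = s' *+ p.
Proof.
move=> pp; have [t ->] := sym_class_surj s; rewrite eval_sym_class => H.
apply: sym_class_div => m.
have := congr1 (fun q : {mpoly _[_]} => q@_m) H; rewrite mcoeff_eval_tensor mcoeff0.
move=> /eqP; rewrite -(dvdz_pcharf (pchar_Fp pp)) => /dvdzP[z ->].
by exists z; rewrite -mulr_natr natz.
Qed.

Lemma inv_content d (V : vectType int) (t : tpow d V) i j :
  t \in sub_pred (inv_sub d) V -> content i = content j -> t i = t j.
Proof.
move=> /forallP tinv /content_perm[s ->].
by have /eqP/ffunP/(_ i) := tinv s; rewrite ffunE => ->.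
Qed.

(** * Generators of the fourth divided power *)

Notation o0 := (@Ordinal 4 0 isT).
Notation o1 := (@Ordinal 4 1 isT).
Notation o2 := (@Ordinal 4 2 isT).
Notation o3 := (@Ordinal 4 3 isT).

Lemma big4 (T : Type) (idx : T) (op : Monoid.law idx) (F : 'I_4 -> T) :
  \big[op/idx]_k F k = op (F o0) (op (F o1) (op (F o2) (F o3))).
Proof.
rewrite !big_ord_recl big_ord0 Monoid.mulm1.
by do ![congr (op _ _)]; congr (F _); apply: val_inj.
Qed.

Lemma sub_closed_mulz (T : zmodType) (P : T -> Prop) :
  (forall x y, P x -> P y -> P (x - y)) -> forall x z, P x -> P (x *~ z).
Proof.
move=> PB x z Px; have P0 : P 0 by rewrite -(subrr x); apply: PB.
have PN y : P y -> P (- y) by rewrite -[- y]sub0r; apply: PB.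
have Pn k : P (x *+ k).
  elim: k => [|k Pk]; first by rewrite mulr0n.
  by rewrite mulrSr -[x in _ + x]opprK; apply: PB => //; apply: PN.
by case: z => k; [apply: Pn | apply/PN/Pn].
Qed.

Section Generators.
Variable V : vectType int.
Local Notation n := (dim V).
Implicit Types (v w : V) (t : tpow 4 V).

(* The digits are the divided powers: [gamma211 v w x] is gamma_2(v) w x. *)
Definition gamma4 v : tpow 4 V := tens [ffun=> v].
Definition gamma31 v w : tpow 4 V := \sum_k tens (upd [ffun=> v] k w).

Lemma gamma4_inv v : gamma4 v \in sub_pred (inv_sub 4) V.
Proof.
apply/forallP => s; rewrite tperm_act_tens; apply/eqP; congr (tens _).
by apply/ffunP => k; rewrite !ffunE.
Qed.

Lemma gamma31_inv v w : gamma31 v w \in sub_pred (inv_sub 4) V.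
Proof.
apply/forallP => s; apply/eqP; rewrite raddf_sum [RHS](reindex_inj (@perm_inj _ s)).
apply: eq_bigr => k _ /=; rewrite tperm_act_tens; congr (tens _).
apply/ffunP => l; rewrite !ffunE; congr (if _ then _ else _).
by apply/eqP/eqP => [<-|->]; rewrite ?permK ?permKV.
Qed.

Lemma gamma31D v : {morph gamma31 v : x y / x + y}.
Proof.
by move=> x y; rewrite -big_split; apply: eq_bigr => k _; rewrite tens_multi_additive.
Qed.

Lemma gamma31_diag v : gamma31 v v = gamma4 v *+ 4.
Proof.
rewrite /gamma31 (eq_bigr (fun=> gamma4 v)) ?sumr_const ?card_ord // => k _.
by congr (tens _); apply/ffunP => l; rewrite !ffunE; case: eqP.
Qed.

Lemma tens0 d (v : {ffun 'I_d -> V}) k : v k = 0 -> tens v = 0.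
Proof.
by move=> vk; apply/ffunP => i; rewrite !ffunE (bigD1 k) //= vk linear0 mxE mul0r.
Qed.

Lemma gamma310 w : gamma31 0 w = 0.
Proof.
rewrite /gamma31 big1 // => k _.
have /pred0Pn[l] : #|[pred l : 'I_4 | l != k]| != 0%N by rewrite cardC1 card_ord.
by move=> /negPf lk; apply: (@tens0 _ _ l); rewrite !ffunE lk.
Qed.

Lemma gamma31r0 v : gamma31 v 0 = 0.
Proof. by apply: (addrI (gamma31 v 0)); rewrite -gamma31D !addr0. Qed.

Local Notation co v j k := (v2r v 0 ((j : {ffun _ -> _}) k)).

Lemma gamma4E v j : gamma4 v j = co v j o0 * co v j o1 * co v j o2 * co v j o3.
Proof. by rewrite ffunE big4 /= !ffunE !mulrA. Qed.

Lemma gamma31E v w j : gamma31 v w j =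
  co w j o0 * co v j o1 * co v j o2 * co v j o3 +
  co v j o0 * co w j o1 * co v j o2 * co v j o3 +
  co v j o0 * co v j o1 * co w j o2 * co v j o3 +
  co v j o0 * co v j o1 * co v j o2 * co w j o3.
Proof. by rewrite sum_ffunE big4 /= !ffunE !big4 /= !ffunE /= !mulrA !addrA. Qed.

Lemma tpowB (s t : tpow 4 V) j : (s - t) j = s j - t j.
Proof. by rewrite !ffunE. Qed.

(** The addition formula for gamma_4(v + w) isolates gamma_2(v) gamma_2(w), and polarization then
    yields gamma_2(v) w x and v w x y. Only differences of [gamma4] and [gamma31] occur, so a
    predicate closed under subtraction passes to all of them. *)
Definition gamma22 v w := gamma4 (v + w) - gamma4 v - gamma4 w - gamma31 v w - gamma31 w v.
Definition gamma211 v w x := gamma22 v (w + x) - gamma22 v w - gamma22 v x.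
Definition gamma1111 v w x y := gamma211 (v + w) x y - gamma211 v x y - gamma211 w x y.

Lemma gamma22E v w j : let C a b c d := co a j o0 * co b j o1 * co c j o2 * co d j o3 in
  gamma22 v w j = C v v w w + C v w v w + C v w w v + C w v v w + C w v w v + C w w v v.
Proof. by move=> C; rewrite /gamma22 /C !tpowB !gamma4E !gamma31E raddfD !mxE; ring. Qed.

Lemma gamma211E v w x j : let C a b c d := co a j o0 * co b j o1 * co c j o2 * co d j o3 in
  gamma211 v w x j = C v v w x + C v w v x + C v w x v + C w v v x + C w v x v + C w x v v
   + C v v x w + C v x v w + C v x w v + C x v v w + C x v w v + C x w v v.
Proof. by move=> C; rewrite /gamma211 /C 2!tpowB !gamma22E raddfD !mxE; ring. Qed.

Lemma gamma1111E v w x y j : let C a b c d := co a j o0 * co b j o1 * co c j o2 * co d j o3 in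
  let D a b c d := C a b c d + C a b d c + C a c b d + C a c d b + C a d b c + C a d c b in
  gamma1111 v w x y j = D v w x y + D w v x y + D x v w y + D y v w x.
Proof. by move=> C D; rewrite /gamma1111 /D /C 2!tpowB !gamma211E raddfD !mxE; ring. Qed.

Definition mk (T : Type) (a b c d : T) : {ffun 'I_4 -> T} :=
  [ffun k : 'I_4 => nth a [:: a; b; c; d] k].

Lemma mkE T (j : {ffun 'I_4 -> T}) : j = mk (j o0) (j o1) (j o2) (j o3).
Proof.
by apply/ffunP => -[[|[|[|[|//]]]] lt4]; rewrite ffunE /=; congr (j _); apply: val_inj.
Qed.

Lemma content_mk (a b c d : 'I_n) : content (mk a b c d) = (U_(a) + U_(b) + U_(c) + U_(d))%MM.
Proof. by rewrite /content big4 /= !ffunE /= !addmA. Qed.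

Lemma contentE_mk (j : {ffun 'I_4 -> 'I_n}) : content j = content (mk (j o0) (j o1) (j o2) (j o3)).
Proof. by rewrite -mkE. Qed.

Lemma v2r_bvec (a b : 'I_n) : v2r (bvec a : V) 0 b = (b == a)%:R.
Proof. by rewrite /bvec r2vK mxE eqxx. Qed.

Section Polarization.
Variable Q : tpow 4 V -> Prop.
Hypothesis QB : forall s t, Q s -> Q t -> Q (s - t).
Hypothesis Q4 : forall v, Q (gamma4 v).
Hypothesis Q31 : forall v w, Q (gamma31 v w).

Lemma closed_gamma22 v w : Q (gamma22 v w).
Proof. exact: QB (QB (QB (QB (Q4 _) (Q4 _)) (Q4 _)) (Q31 _ _)) (Q31 _ _). Qed.

Lemma closed_gamma211 v w x : Q (gamma211 v w x).
Proof. exact: QB (QB (closed_gamma22 _ _) (closed_gamma22 _ _)) (closed_gamma22 _ _). Qed.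

Lemma closed_gamma1111 v w x y : Q (gamma1111 v w x y).
Proof. exact: QB (QB (closed_gamma211 _ _ _) (closed_gamma211 _ _ _)) (closed_gamma211 _ _ _). Qed.

End Polarization.

Lemma invB s t : s \in sub_pred (inv_sub 4) V -> t \in sub_pred (inv_sub 4) V ->
  s - t \in sub_pred (inv_sub 4) V.
Proof. exact: (sub_zmod_closed (inv_sub 4) V).2. Qed.

Section Span.
Variable Q : tpow 4 V -> Prop.
Hypothesis QB : forall s t, Q s -> Q t -> Q (s - t).
Hypothesis Q4 : forall v, Q (gamma4 v).
Hypothesis Q31 : forall v w, Q (gamma31 v w).

(* Such a [g] is the sum of the S_4-orbit of the basis tensor [i]. *)
Definition orbit_witness i := exists g, [/\ Q g, g \in sub_pred (inv_sub 4) V, g i = 1 &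
  forall j, g j != 0 -> content j = content i].

Lemma orbit_witness_content i j : content i = content j -> orbit_witness i -> orbit_witness j.
Proof.
move=> Em [g [Qg gi g1 gs]]; exists g; split=> // [|k gk]; last by rewrite gs.
by rewrite -(inv_content gi Em).
Qed.

Lemma add_neq0 (x y : int) : x + y != 0 -> x != 0 \/ y != 0.
Proof. by have [->|] := eqVneq x 0; [rewrite add0r; right | left]. Qed.

Lemma bvec_prod_neq0 (a b c d x y z w : 'I_n) :
  (x == a)%:R * (y == b)%:R * (z == c)%:R * (w == d)%:R != 0 :> int ->
  content (mk x y z w) = content (mk a b c d).
Proof.
rewrite !mulf_eq0 !negb_or !Num.Theory.pnatr_eq0 !eqb0 !negbK.
by move=> /andP[/andP[/andP[/eqP-> /eqP->] /eqP->] /eqP->].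
Qed.

(** If a sum of products of Kronecker deltas is nonzero at j, then one of the products is, and this
    product determines j up to a permutation of its entries. *)
Ltac supp j := rewrite (contentE_mk j); repeat
  match goal with |- is_true (negb (eq_op (GRing.add _ _) _)) -> _ =>
    let H := fresh in let H' := fresh in intro H;
    destruct (add_neq0 H) as [H'|H']; revert H'; clear H end;
  let H := fresh in intro H; rewrite (bvec_prod_neq0 H);
  rewrite !content_mk; apply/mnmP => ?; rewrite !mnmDE; ring.

Lemma orbit_witness_aaaa a : orbit_witness (mk a a a a).
Proof.
exists (gamma4 (bvec a)); split=> [|||j]; rewrite ?gamma4_inv // gamma4E !v2r_bvec.
  by rewrite !ffunE /= !eqxx.
supp j.
Qed.

Lemma orbit_witness_aaab a b : a != b -> orbit_witness (mk a a a b).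
Proof.
move=> ab; have ba := ab; rewrite eq_sym in ba.
exists (gamma31 (bvec a) (bvec b)); split=> [|||j]; rewrite ?gamma31_inv // gamma31E !v2r_bvec.
  by rewrite !ffunE /= !eqxx ?(negPf ab) ?(negPf ba).
supp j.
Qed.

Lemma orbit_witness_aabb a b : a != b -> orbit_witness (mk a a b b).
Proof.
move=> ab; have ba := ab; rewrite eq_sym in ba.
exists (gamma22 (bvec a) (bvec b)).
split=> [|||j]; [exact: closed_gamma22 |
    exact: (closed_gamma22 invB gamma4_inv gamma31_inv) | |];
  rewrite gamma22E !v2r_bvec.
  by rewrite !ffunE /= !eqxx ?(negPf ab) ?(negPf ba).
supp j.
Qed.

Lemma orbit_witness_aabc a b c : a != b -> a != c -> b != c -> orbit_witness (mk a a b c).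
Proof.
move=> ab ac bc; have [ba [ca cb]] : b != a /\ c != a /\ c != b.
  by rewrite (eq_sym b) (eq_sym c) (eq_sym c).
exists (gamma211 (bvec a) (bvec b) (bvec c)).
split=> [|||j]; [exact: closed_gamma211 |
    exact: (closed_gamma211 invB gamma4_inv gamma31_inv) | |];
  rewrite gamma211E !v2r_bvec.
  by rewrite !ffunE /= !eqxx ?(negPf ab, negPf ba, negPf ac, negPf ca, negPf bc, negPf cb).
supp j.
Qed.

Lemma orbit_witness_abcd a b c d : uniq [:: a; b; c; d] -> orbit_witness (mk a b c d).
Proof.
move=> U; have /= := U; rewrite !inE !negb_or -!andbA => /and5P[ab ac ad bc /and3P[bd cd _]].
have := rev_uniq [:: a; b; c; d]; rewrite U /= !inE !negb_or -!andbA.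
move=> /and5P[dc db da cb /and3P[ca ba _]].
exists (gamma1111 (bvec a) (bvec b) (bvec c) (bvec d)).
split=> [|||j]; [exact: closed_gamma1111 |
    exact: (closed_gamma1111 invB gamma4_inv gamma31_inv) | |];
  rewrite gamma1111E !v2r_bvec.
  rewrite !ffunE /= !eqxx ?(negPf ab, negPf ba, negPf ac, negPf ca, negPf bc, negPf cb).
  by rewrite ?(negPf ad, negPf da, negPf bd, negPf db, negPf cd, negPf dc).
supp j.
Qed.

Ltac sort_mk L := apply: (orbit_witness_content _ L);
  rewrite !content_mk; apply/mnmP => ?; rewrite !mnmDE; ring.

(** The coincidences among the four entries of i form one of the five partitions of 4. After a
    permutation, i has one of the sorted patterns aaaa, aaab, aabb, aabc, abcd. *)
Lemma orbit_witness_all i : orbit_witness i.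
Proof.
rewrite (mkE i); move: (i o0) (i o1) (i o2) (i o3) => a b c d.
have [<-|ab] := eqVneq a b; have [<-|ac] := eqVneq a c.
- have [<-|ad] := eqVneq a d; [exact: orbit_witness_aaaa | exact: orbit_witness_aaab].
- have [<-|ad] := eqVneq a d; first by sort_mk (orbit_witness_aaab ac).
  have [<-|cd] := eqVneq c d; [exact: orbit_witness_aabb | exact: orbit_witness_aabc].
- have [<-|ad] := eqVneq a d; first by sort_mk (orbit_witness_aaab ab).
  have [<-|bd] := eqVneq b d; first by sort_mk (orbit_witness_aabb ab).
  by sort_mk (orbit_witness_aabc ab ad bd).
have ba : b != a by rewrite eq_sym.
have ca : c != a by rewrite eq_sym.
have [<-|bc] := eqVneq b c.
  have [<-|ad] := eqVneq a d; first by sort_mk (orbit_witness_aabb ab).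
  have [<-|bd] := eqVneq b d; first by sort_mk (orbit_witness_aaab ba).
  by sort_mk (orbit_witness_aabc ba bd ad).
have cb : c != b by rewrite eq_sym.
have [<-|ad] := eqVneq a d; first by sort_mk (orbit_witness_aabc ab ac bc).
have [<-|bd] := eqVneq b d; first by sort_mk (orbit_witness_aabc ba bc ac).
have [<-|cd] := eqVneq c d; first by sort_mk (orbit_witness_aabc ca cb ab).
by apply: orbit_witness_abcd; rewrite /= !inE !negb_or ab ac ad bc bd cd.
Qed.

(* Subtracting [t i] times the orbit sum of [i] strictly shrinks the support. *)
Lemma inv_span t : t \in sub_pred (inv_sub 4) V -> Q t.
Proof.
have [m le_m] := ubnP #|[pred j | t j != 0]|.
elim: m => // m IHm in t le_m * => tinv.
have [i ti|t0] := pickP [pred j | t j != 0]; last first.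
  have -> : t = gamma4 0 - gamma4 0.
    rewrite subrr; apply/ffunP => j; rewrite ffunE; apply/eqP.
    by have /negbFE := t0 j.
  exact: QB.
have [g [Qg ginv g1 gs]] := orbit_witness_all i.
have tE j : (t - g *~ t i) j = t j - g j * t i.
  by rewrite ffunE [X in _ + X]ffunE tpowMzE -mulrzl intz mulrC.
have -> : t = (t - g *~ t i) - g *~ (- t i) by rewrite mulrNz opprK subrK.
apply: QB; last exact: (sub_closed_mulz QB).
have sub j : t j == 0 -> (t - g *~ t i) j == 0.
  move=> /eqP tj; rewrite tE tj sub0r oppr_eq0 mulf_eq0.
  have [//|gj] := eqVneq (g j) 0.
  by rewrite -tj (inv_content tinv (gs _ gj)) eqxx orbT.
apply: IHm; last by apply: invB => //; apply: (sub_closed_mulz invB).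
rewrite -ltnS (leq_trans _ le_m) // ltnS; apply: proper_card; apply/properP; split.
  by apply/subsetP => j; rewrite !inE; apply: contra; apply: sub.
by exists i; rewrite ?inE // tE g1 mul1r subrr eqxx.
Qed.

End Span.
End Generators.

(** * Lifting the norm of the fourth tensor power *)

Definition proj_away n (k : 'I_n) : 'Hom(Zn n, Zn n) :=
  hom_of (fun i => if i == k then 0 else basis i).

Lemma hom_of_comp_proj_away n (V : vectType int) (v : 'I_n -> V) k :
  (hom_of v \o proj_away k)%VF = hom_of (fun i => if i == k then 0 else v i).
Proof.
rewrite comp_hom_of; congr (hom_of _); apply/funext => i /=.
by case: eqP => _; rewrite ?linear0 ?hom_of_basis.
Qed.

Lemma proj_away_idem n (k : 'I_n) : (proj_away k \o proj_away k)%VF = proj_away k.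
Proof. by rewrite hom_of_comp_proj_away; congr (hom_of _); apply/funext => i; case: eqP. Qed.

Lemma proj_away_comm n (k l : 'I_n) :
  (proj_away k \o proj_away l)%VF = (proj_away l \o proj_away k)%VF.
Proof.
by rewrite !hom_of_comp_proj_away; congr (hom_of _); apply/funext => i; do 2!case: eqP.
Qed.

(** * Cross effects and the degree of a functor *)

Section Cross.
Variables (F : Fun) (n : nat).
Implicit Types (x : F (Zn n)) (l : seq 'I_n).

(* For [l = enum 'I_n] this projects onto the n-th cross effect. *)
Definition cross_effect l x : F (Zn n) := foldr (fun k y => y - fmap F (proj_away k) y) x l.

(** The projections are commuting idempotents, so F(pi_k) annihilates the factor 1 - F(pi_k) of the
    product. *)
Lemma proj_away_cross_effect l x k : k \in l -> fmap F (proj_away k) (cross_effect l x) = 0.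
Proof.
elim: l => //= a l IHl; rewrite inE raddfB -!fmap_comp => /predU1P[->|kl].
  by rewrite proj_away_idem subrr.
by rewrite proj_away_comm fmap_comp IHl // raddf0 subrr.
Qed.

Lemma cross_effect_id l x : (forall k, fmap F (proj_away k) x = 0) -> cross_effect l x = x.
Proof. by move=> x0; elim: l => //= a l ->; rewrite x0 subr0. Qed.

End Cross.

Lemma cross_effect_nat (F G : Fun) (h : nat_trans F G) n l (x : F (Zn n)) :
  h _ (cross_effect l x) = cross_effect l (h _ x).
Proof. by elim: l => //= a l <-; rewrite raddfB nt_natural. Qed.

Lemma f2mx_proj_away n (k a b : 'I_n) :
  f2mx (proj_away k) a b = (a == b)%:R * (b != k)%:R.
Proof.
have := row_f2mx (proj_away k) a; rewrite hom_of_basis => /rowP/(_ b); rewrite mxE => ->.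
case: (eqVneq a b) => [->|ab].
  by case: eqP => _; rewrite ?linear0 ?mxE ?mulr0 // /basis v2r_bvec eqxx mulr1.
by case: eqP => _; rewrite ?linear0 ?mxE ?mul0r // /basis v2r_bvec eq_sym (negPf ab).
Qed.

Lemma prod_codom_neq (I J : finType) (j : {ffun I -> J}) k :
  \prod_m ((j m != k)%:R : int) = (k \notin codom j)%:R.
Proof.
case: (boolP (k \in codom j)) => [/codomP[m ->]|kj].
  by rewrite (bigD1 m) //= eqxx mul0r.
rewrite big1 // => m _; case: eqP => // jk.
by case/codomP: kj; exists m.
Qed.

(** Each factor 1 - F(pi_k) keeps the basis tensors in which e_k occurs and kills the others. *)
Lemma cross_effect_tensor d n l (t : Tensor d (Zn n)) (j : {ffun 'I_d -> 'I_n}) :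
  (cross_effect l t : tpow d (Zn n)) j = t j *+ all (mem (codom j)) l.
Proof.
elim: l => [|k l IHl] //=; rewrite ffunE [X in _ + X]ffunE.
set u := cross_effect l t in IHl *.
have -> : (fmap (Tensor d) (proj_away k) u : tpow d (Zn n)) j = u j *+ (k \notin codom j).
  transitivity (\sum_i u i * (i == j)%:R * (k \notin codom j)%:R).
    rewrite ffunE; apply: eq_bigr => i _; rewrite -mulrA; congr (_ * _).
    rewrite -prod_codom_neq -prod_delta -big_split.
    by apply: eq_bigr => m _; apply: f2mx_proj_away.
  by rewrite -mulr_suml sum_delta mulr_natr.
by rewrite IHl; case: (k \in _); rewrite ?mulr0n ?subr0 ?subrr.
Qed.

Lemma codom_missing d n (j : {ffun 'I_d -> 'I_n}) : (d < n)%N ->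
  all (mem (codom j)) (enum 'I_n) = false.
Proof.
move=> lt_dn; apply/negbTE; apply: contraL lt_dn => /allP H; rewrite -leqNgt.
rewrite -[n in (n <= _)%N]card_ord -[d]card_ord.
apply: leq_trans _ (leq_image_card j predT).
by apply: subset_leq_card; apply/subsetP => k _; apply: H; rewrite mem_enum.
Qed.

(** Sym^d has degree at most d: z equals its own cross effect, which comes from a cross effect in
    the tensor power, and a word of length d < n cannot contain all n letters. *)
Lemma Sym_cross_effect0 d n (z : Sym d (Zn n)) : (d < n)%N ->
  (forall k, fmap (Sym d) (proj_away k) z = 0) -> z = 0.
Proof.
move=> lt_dn z0; rewrite -(cross_effect_id (enum 'I_n) z0).
have [t ->] := sym_class_surj z; rewrite /sym_class -cross_effect_nat.
suff -> : cross_effect (enum 'I_n) (t : Tensor d (Zn n)) = 0 by rewrite raddf0.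
by apply/ffunP => j; rewrite cross_effect_tensor ffunE codom_missing.
Qed.

Section Norm.
Variables (d : nat).
Implicit Types U V : vectType int.

Definition symmetrize V (t : tpow d V) : tpow d V := \sum_(s : 'S_d) tperm_act s t.

Lemma symmetrize_inv V (t : tpow d V) : symmetrize t \in sub_pred (inv_sub d) V.
Proof.
apply/forallP => s; apply/eqP; rewrite raddf_sum [RHS](reindex_inj (mulIg s)) /=.
apply: eq_bigr => r _; apply/ffunP => i; rewrite !ffunE; congr (t _).
by apply/ffunP => k; rewrite !ffunE permM.
Qed.

Definition sym_norm V (t : tpow d V) : Gamma d V :=
  exist (fun x : tpow d V => x \in sub_pred (inv_sub d) V) _ (symmetrize_inv t).

Fact sym_norm_is_zmod_morphism V : zmod_morphism (@sym_norm V).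
Proof.
move=> s t; apply: val_inj; rewrite /= -sumrB; apply: eq_bigr => r _.
by rewrite raddfB.
Qed.

HB.instance Definition _ V := GRing.isZmodMorphism.Build (tpow d V) (Gamma d V)
  (@sym_norm V) (@sym_norm_is_zmod_morphism V).

Lemma sym_norm_map U V (f : 'Hom(U, V)) t :
  sym_norm (tpow_map f t) = fmap (Gamma d) f (sym_norm t).
Proof.
apply: val_inj; rewrite /= raddf_sum; apply: eq_bigr => s _.
by rewrite /= tpow_map_act.
Qed.

Lemma sym_norm_val V (g : Gamma d V) : sym_norm (val g) = g *+ d`!.
Proof.
apply: val_inj; rewrite raddfMn /= /symmetrize (eq_bigr (fun=> val g)) => [|s _].
  by rewrite sumr_const card_Sn.
by have /forallP/(_ s)/eqP := valP g.
Qed.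

Lemma tens_ext V (A : zmodType) (h h' : {additive tpow d V -> A}) :
  (forall v, h (tens v) = h' (tens v)) -> h =1 h'.
Proof.
move=> hh'; have mh : multi_additive (fun v => h (tens v)).
  by move=> v k x y; rewrite tens_multi_additive raddfD.
have [h0 _ h0u] := tens_universal mh.
by move=> t; rewrite (h0u h) // (h0u h').
Qed.

End Norm.

Section Lift.
Variables (G : Fun) (E : extension (Gamma 4) G).
(** The fifth cross effect of G vanishes, that is, G has degree at most 4. *)
Hypothesis G_cross : forall z : G (Zn 5), (forall k, fmap G (proj_away k) z = 0) -> z = 0.
Local Notation M := (ext_mid E).

Definition tens_basis : tpow 4 (Zn 4) := tens [ffun k => basis k].

(** Any preimage may be replaced by its cross effect. The image is unchanged, because the norm of
    the tensor of all four basis vectors is already killed by every projection. *)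
Lemma universal_lift : exists u : M (Zn 4),
  ext_out E _ u = sym_norm tens_basis /\ forall k, fmap M (proj_away k) u = 0.
Proof.
have [u0 u0E] := ext_out_surj E (sym_norm tens_basis).
exists (cross_effect (enum 'I_4) u0); split=> [|k];
  last by rewrite proj_away_cross_effect ?mem_enum.
rewrite cross_effect_nat u0E cross_effect_id // => k.
rewrite -sym_norm_map tpow_map_tens (@tens0 _ _ _ k) ?raddf0 //.
by rewrite !ffunE hom_of_basis eqxx.
Qed.

Section Universal.
Variable u : M (Zn 4).
Hypothesis uE : ext_out E _ u = sym_norm tens_basis.
Hypothesis u_proj : forall k, fmap M (proj_away k) u = 0.

Lemma hom_of_proj_away (V : vectType int) (v : 'I_4 -> V) k : v k = 0 -> fmap M (hom_of v) u = 0.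
Proof.
move=> vk; suff -> : hom_of v = (hom_of v \o proj_away k)%VF by rewrite fmap_comp u_proj raddf0.
by rewrite hom_of_comp_proj_away; congr (hom_of _); apply/funext => i; case: eqP => // ->.
Qed.

Lemma out_hom_of (V : vectType int) (v : {ffun 'I_4 -> V}) :
  ext_out E V (fmap M (hom_of v) u) = sym_norm (tens v).
Proof.
rewrite nt_natural uE -sym_norm_map tpow_map_tens; congr (sym_norm (tens _)).
by apply/ffunP => k; rewrite !ffunE hom_of_basis.
Qed.

(* The deviation from additivity in one variable is natural in five vectors
   and vanishes when one of them does. *)
Lemma hom_of_multi_additive (V : vectType int) :
  multi_additive (fun v : {ffun 'I_4 -> V} => fmap M (hom_of v) u).
Proof.
move=> v k x y /=.
(* The universal case lives over Z^5: four vectors b i, and a fifth vector m to be added in slot k.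
   The map given by z below specializes them to v with x in slot k, and to y. *)
pose b (i : 'I_4) : Zn 5 := basis (lift ord_max i).
pose m : Zn 5 := basis ord_max.
pose B := [ffun i => b i].
pose w := fmap M (hom_of (upd B k (b k + m))) u - fmap M (hom_of (upd B k (b k))) u
  - fmap M (hom_of (upd B k m)) u.
pose z (i : 'I_5) := oapp (upd v k x) y (unlift ord_max i).
have zb i : hom_of z (b i) = upd v k x i by rewrite hom_of_basis /z liftK.
have zm : hom_of z m = y by rewrite hom_of_basis /z unlift_none.
have updE a a' : hom_of z a = a' -> (hom_of z \o hom_of (upd B k a))%VF = hom_of (upd v k a').
  move=> az; rewrite comp_hom_of; congr (hom_of _); apply/funext => i /=.
  by rewrite !ffunE; case: eqP => // /eqP /negPf ik; rewrite zb ffunE ik.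
have w0 : w = 0.
  have [|a wa] := (ext_exact w).1.
    rewrite !raddfB /= !out_hom_of tens_multi_additive raddfD /=.
    by rewrite -addrA -opprD subrr.
  rewrite wa; suff -> : a = 0 by rewrite raddf0.
  apply: G_cross => l; apply: (ext_in_inj (e := E)); rewrite raddf0 nt_natural -wa.
  have lb i : proj_away l (b i) = if lift ord_max i == l then 0 else b i by rewrite hom_of_basis.
  have lm' : proj_away l m = if ord_max == l then 0 else m by rewrite hom_of_basis.
  pose B' := [ffun i => proj_away l (b i)].
  have E' a' : (proj_away l \o hom_of (upd B k a'))%VF = hom_of (upd B' k (proj_away l a')).
    rewrite comp_hom_of; congr (hom_of _); apply/funext => i /=.
    by rewrite !ffunE; case: eqP.
  rewrite !raddfB /= -!fmap_comp !E' raddfD /=.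
  have updk a' : upd B' k a' k = a' by rewrite ffunE eqxx.
  (* If l removes m, the first two terms of w cancel and the third is zero. If l removes b k, the
     first and third cancel and the second is zero. If l removes another b i, all three are zero. *)
  have [i li|lm] := unliftP ord_max l; last first.
    rewrite lm' lm eqxx addr0 subrr sub0r.
    by rewrite (hom_of_proj_away (k := k)) ?oppr0.
  have -> : proj_away l m = m by rewrite lm' li (negPf (neq_lift _ _)).
  have bi : proj_away l (b i) = 0 by rewrite lb li eqxx.
  have [<-|ik] := eqVneq i k.
    by rewrite bi add0r addrAC subrr sub0r (hom_of_proj_away (k := i)) ?oppr0 // ffunE eqxx.
  by rewrite !(hom_of_proj_away (k := i)) ?subr0 // !ffunE (negPf ik).
have := congr1 (fmap M (hom_of z)) w0.
have zbk : hom_of z (b k) = x by rewrite zb ffunE eqxx.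
have zD : hom_of z (b k + m) = x + y by rewrite raddfD /= zbk zm.
rewrite !raddfB raddf0 /= -!fmap_comp (updE _ _ zD) (updE _ _ zbk) (updE _ _ zm).
by move/eqP; rewrite -addrA -opprD subr_eq0 => /eqP.
Qed.

End Universal.

(** Moving u along four vectors of V is multi-additive, hence gives a map from T^4 V to M V that
    covers the norm. On symmetric tensors the norm is multiplication by 4! = 24. *)
Lemma lift_24 : exists lam : nat_trans (Gamma 4) M,
  forall V g, ext_out E V (lam V g) = g *+ 24.
Proof.
have [u [uE u_proj]] := universal_lift.
pose h V := s2val (cid2 (tens_universal (hom_of_multi_additive uE u_proj (V := V)))).
have hE V v : h V (tens v) = fmap M (hom_of v) u.
  exact: (s2valP (cid2 (tens_universal (hom_of_multi_additive uE u_proj (V := V))))).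
pose lam V : {additive Gamma 4 V -> M V} := h V \o sub_incl (inv_sub 4) V.
have lam_nat (U V : vectType int) (f : 'Hom(U, V)) x :
    lam V (fmap (Gamma 4) f x) = fmap M f (lam U x).
  rewrite /lam /=; move: (sval x) => t {x}.
  apply: (tens_ext (h := h V \o @tpow_map 4 U V f) (h' := fmap M f \o h U)) => v /=.
  rewrite tpow_map_tens !hE -fmap_comp comp_hom_of; congr (fmap M (hom_of _) u).
  by apply/funext => k; rewrite ffunE.
exists (MkNat lam_nat) => V g.
have -> : g *+ 24 = sym_norm (val g) by rewrite sym_norm_val.
rewrite /lam /=; move: (val g) => t {g}.
apply: (tens_ext (h := ext_out E V \o h V) (h' := @sym_norm 4 V)) => v /=.
by rewrite hE out_hom_of.
Qed.

End Lift.

(** * The invariant of an extension *)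

Definition vec2 (T : Type) (a b : T) (k : 'I_2) : T := nth a [:: a; b] k.
Definition vec3 (T : Type) (a b c : T) (k : 'I_3) : T := nth a [:: a; b; c] k.

Lemma eq_I2 (T : Type) (f g : 'I_2 -> T) :
  f ord0 = g ord0 -> f ord_max = g ord_max -> f = g.
Proof.
move=> f0 f1; apply/funext => -[[|[|//]] lt2].
  by rewrite (_ : Ordinal lt2 = ord0) //; apply: val_inj.
by rewrite (_ : Ordinal lt2 = ord_max) //; apply: val_inj.
Qed.

Lemma lin_eval_basis (R : comNzRingType) n (x : 'I_(dim (Zn n)) -> R) (i : 'I_n) :
  lin_eval x (basis i) = x i.
Proof.
rewrite /lin_eval (bigD1 (i : 'I_(dim (Zn n)))) //= /basis
  v2r_bvec eqxx mul1r big1 ?addr0 // => j ji.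
by rewrite v2r_bvec (negPf ji) mul0r.
Qed.

Fact lin_eval_is_zmod_morphism (R : comNzRingType) (V : vectType int) (x : 'I_(dim V) -> R) :
  zmod_morphism (lin_eval x).
Proof.
move=> v w; rewrite /lin_eval -sumrB; apply: eq_bigr => i _.
by rewrite raddfB !mxE rmorphB mulrBl.
Qed.

HB.instance Definition _ (R : comNzRingType) (V : vectType int) (x : 'I_(dim V) -> R) :=
  GRing.isZmodMorphism.Build V R (lin_eval x) (lin_eval_is_zmod_morphism x).

Lemma pull_hom_of (R : comNzRingType) n (V : vectType int) (v : 'I_n -> V) (x : 'I_(dim V) -> R) :
  pull_coords (hom_of v) x = fun i : 'I_n => lin_eval x (v i).
Proof. by apply/funext => i; rewrite /pull_coords -(hom_of_basis v i). Qed.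

Local Notation S := (Sym 4).
Local Notation "'e0'" := (basis (ord0 : 'I_2)).
Local Notation "'e1'" := (basis (ord_max : 'I_2)).

Definition ev2 (R : comNzRingType) (a b : R) : S (Zn 2) -> R := @eval_sym 4 R (Zn 2) (vec2 a b).
HB.instance Definition _ (R : comNzRingType) (a b : R) :=
  GRing.Additive.copy (ev2 a b) (@eval_sym 4 R (Zn 2) (vec2 a b)).

Lemma ev2_map (R : comNzRingType) n (v w : Zn n) (x : 'I_n -> R) (s : S (Zn 2)) :
  eval_sym (x : 'I_(dim (Zn n)) -> R) (fmap S (hom_of (vec2 v w)) s) =
    ev2 (lin_eval (x : 'I_(dim (Zn n)) -> R) v) (lin_eval (x : 'I_(dim (Zn n)) -> R) w) s.
Proof. by rewrite eval_sym_map pull_hom_of; congr (eval_sym _ s); apply: eq_I2. Qed.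

(* The coefficient at e_0^(4-i) e_1^i. *)
Definition bcoef (i : nat) (s : S (Zn 2)) : int := (ev2 1 'X s)`_i.

Fact bcoef_is_zmod_morphism i : zmod_morphism (bcoef i).
Proof. by move=> s t; rewrite /bcoef raddfB coefB. Qed.
HB.instance Definition _ i := GRing.isZmodMorphism.Build (S (Zn 2)) int (bcoef i)
  (bcoef_is_zmod_morphism i).

(** The index tuples j are grouped by w j, the number of factors equal to e_1; each contributes a^(4
    - w j) b^(w j). *)
Lemma ev2E (R : comNzRingType) (a b : R) s :
  ev2 a b s = \sum_(i < 5) (bcoef i s)%:~R * (a ^+ (4 - i) * b ^+ i).
Proof.
have [t ->] := sym_class_surj s; rewrite /bcoef /ev2 eval_sym_class.
pose w (j : {ffun 'I_4 -> 'I_2}) : nat := (\sum_k j k)%N.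
have sum4 F : (\sum_(k < 4) F k = F o0 + F o1 + F o2 + F o3)%N.
  by rewrite big4 /= !addnA.
have w5 j : (w j < 5)%N.
  by rewrite ltnS /w sum4 /=; do 4![case: (j _) => [[|[|//]] ?] /=].
have prodE (T : comNzRingType) (x y : T) (j : {ffun 'I_4 -> 'I_2}) :
    \prod_(k < 4) vec2 x y (j k) = x ^+ (4 - w j) * y ^+ w j.
  transitivity (\prod_(k < 4) (x ^+ (1 - j k) * y ^+ j k)).
    by apply: eq_bigr => k _; case: (j k) => [[|[|//]] ?]; rewrite /vec2 /= ?expr0; ring.
  rewrite big_split /= !prodrXr; congr (x ^+ _ * _).
  rewrite /w !sum4 /=.
  move: (ltn_ord (j o0)) (ltn_ord (j o1)) (ltn_ord (j o2)) (ltn_ord (j o3)).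
  lia.
have coefE i : (eval_tensor (vec2 1 'X : 'I_(dim (Zn 2)) -> {poly int}) t)`_i =
    \sum_(j : {ffun 'I_4 -> 'I_2} | w j == i) t j.
  rewrite /eval_tensor coef_sum [RHS]big_mkcond; apply: eq_bigr => j _ /=.
  rewrite prodE expr1n mul1r mulrzl coefMrz coefXn eq_sym.
  by case: eqP => _; rewrite ?mul0rz // intz.
under [RHS]eq_bigr => i _ do rewrite eval_sym_class coefE rmorph_sum mulr_suml.
rewrite /eval_tensor (partition_big (fun j => Ordinal (w5 j)) predT) //=.
apply: eq_bigr => i _; apply: eq_big => [j|j /eqP <-]; first by rewrite -val_eqE.
by rewrite prodE.
Qed.

(** The quotient needed for [eval_sym_div] is the binary quartic with coefficients z i. For N = 0
    the lemma says that a form with zero coefficients is zero. *)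
Lemma bcoef_div N s : (forall i, (i < 5)%N -> exists z, bcoef i s = z *+ N) ->
  exists s', s = s' *+ N.
Proof.
move=> H; pose z i :=
  if pselect (exists z, bcoef i s = z *+ N) is left h then projT1 (cid h) else 0.
have zE (i : 'I_5) : bcoef i s = z i *+ N.
  rewrite /z; case: pselect => [h|[]]; last exact: H.
  exact: projT2 (cid h).
pose X (k : 'I_2) : {mpoly int[dim (Zn 2)]} := genX int (k : 'I_(dim (Zn 2))).
apply: (@eval_sym_div 4 (Zn 2) N s
  (\sum_(i < 5) (z i)%:~R * (X ord0 ^+ (4 - i) * X ord_max ^+ i))).
rewrite -sumrMnl -[LHS]/(eval_sym (X : 'I_(dim (Zn 2)) -> _) s).
have -> : X = vec2 (X ord0) (X ord_max) by apply: eq_I2.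
rewrite -[LHS]/(ev2 _ _ _) ev2E; apply: eq_bigr => i _.
by rewrite zE rmorphMn mulrnAl.
Qed.

(** By [eval_sym_div] at 0, S^4 embeds into a polynomial ring over Z, which has no torsion. *)
Lemma Sym4_torsion_free (V : vectType int) (s : S V) n : s *+ n.+1 = 0 -> s = 0.
Proof.
move=> sn; suff [s' ->] : exists s', s = s' *+ 0 by rewrite mulr0n.
apply: (@eval_sym_div _ _ _ _ 0); rewrite mulr0n; apply/eqP.
have := congr1 (eval_sym (@genX V int)) sn; rewrite raddfMn raddf0 => /mpolyP H.
apply/eqP/mpolyP => m; have := H m; rewrite mcoeffMn mcoeff0 => /eqP.
by rewrite Num.Theory.mulrn_eq0 => /eqP.
Qed.

Definition Gamma4 (V : vectType int) (v : V) : Gamma 4 V :=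
  exist (fun t : tpow 4 V => t \in sub_pred (inv_sub 4) V) _ (gamma4_inv v).
Definition Gamma31 (V : vectType int) (v w : V) : Gamma 4 V :=
  exist (fun t : tpow 4 V => t \in sub_pred (inv_sub 4) V) _ (gamma31_inv v w).

Lemma fmap_Gamma4 (U V : vectType int) (f : 'Hom(U, V)) v :
  fmap (Gamma 4) f (Gamma4 v) = Gamma4 (f v).
Proof.
apply: val_inj; rewrite /= tpow_map_tens; congr (tens _).
by apply/ffunP => k; rewrite !ffunE.
Qed.

Lemma fmap_Gamma31 (U V : vectType int) (f : 'Hom(U, V)) v w :
  fmap (Gamma 4) f (Gamma31 v w) = Gamma31 (f v) (f w).
Proof.
apply: val_inj; rewrite /= raddf_sum; apply: eq_bigr => k _ /=.
rewrite tpow_map_tens; congr (tens _).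
by apply/ffunP => l; rewrite !ffunE; case: eqP => // _; rewrite ffunE.
Qed.

Lemma Gamma310 (V : vectType int) (w : V) : Gamma31 0 w = 0.
Proof. by apply: val_inj; rewrite /= gamma310. Qed.

Lemma Gamma31r0 (V : vectType int) (v : V) : Gamma31 v 0 = 0.
Proof. by apply: val_inj; rewrite /= gamma31r0. Qed.

Lemma Gamma31D (V : vectType int) (v : V) : {morph Gamma31 v : x y / x + y}.
Proof. by move=> x y; apply: val_inj; rewrite /= gamma31D. Qed.

Lemma Gamma31_diag (V : vectType int) (v : V) : Gamma31 v v = Gamma4 v *+ 4.
Proof. by apply: val_inj; rewrite raddfMn /= gamma31_diag. Qed.

Local Notation "'t0'" := (basis (inord 0 : 'I_3)).
Local Notation "'t1'" := (basis (inord 1 : 'I_3)).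
Local Notation "'t2'" := (basis (inord 2 : 'I_3)).

Definition deviation (F : Fun) (x : F (Zn 2)) : F (Zn 3) :=
  fmap F (hom_of (vec2 t0 (t1 + t2))) x - fmap F (hom_of (vec2 t0 t1)) x
  - fmap F (hom_of (vec2 t0 t2)) x.
Arguments deviation F x : clear implicits.

Fact deviation_is_zmod_morphism F : zmod_morphism (deviation F).
Proof.
by move=> x y; rewrite /deviation !raddfB /= !opprK [X in X + _ = _]addrACA [LHS]addrACA.
Qed.
HB.instance Definition _ (F : Fun) := GRing.isZmodMorphism.Build (F (Zn 2)) (F (Zn 3))
  (deviation F) (@deviation_is_zmod_morphism F).

Lemma deviation_nat (F G : Fun) (h : nat_trans F G) x : h _ (deviation F x) = deviation G (h _ x).
Proof. by rewrite /deviation !raddfB /= !nt_natural. Qed.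

Lemma deviation_Gamma31 : deviation (Gamma 4) (Gamma31 e0 e1) = 0.
Proof.
rewrite /deviation !fmap_Gamma31 !hom_of_basis /vec2 /= Gamma31D.
by rewrite -addrA -opprD subrr.
Qed.

(* e_0 is set to 1; the inner variable stands for e_1 and the outer one for e_2. *)
Definition tpoly : S (Zn 3) -> {poly {poly int}} :=
  @eval_sym 4 {poly {poly int}} (Zn 3) (vec3 1 ('X%:P) 'X).
HB.instance Definition _ := GRing.Additive.copy tpoly
  (@eval_sym 4 {poly {poly int}} (Zn 3) (vec3 1 ('X%:P) 'X)).

(* The coefficients at e_0^2 e_1 e_2 and e_0 e_1^2 e_2. *)
Definition dev_class (s : S (Zn 3)) : 'Z_2 * 'Z_3 :=
  (((tpoly s)`_1`_1)%:~R, ((tpoly s)`_1`_2)%:~R).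

Fact dev_class_is_zmod_morphism : zmod_morphism dev_class.
Proof. by move=> s t; rewrite /dev_class raddfB !coefB !rmorphB. Qed.
HB.instance Definition _ := GRing.isZmodMorphism.Build (S (Zn 3)) ('Z_2 * 'Z_3)%type dev_class
  dev_class_is_zmod_morphism.

Lemma coef1_binom (R : comNzRingType) (c : R) i :
  ((c%:P + 'X) ^+ i)`_1 = c ^+ i.-1 *+ i.
Proof.
transitivity ((((c%:P + 'X) ^+ i)^`())`_0); first by rewrite coef_deriv.
rewrite deriv_exp derivD derivC derivX add0r mul1r coefMn; congr (_ *+ _).
by rewrite -horner_coef0 horner_exp !hornerE.
Qed.

(** Only the part linear in e_2 is read off: (e_1 + e_2)^i contributes i e_1^(i-1) e_2, and
    subtracting s(e_0, e_2) removes the contribution of i = 1. *)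
Lemma tpoly_deviation s : (tpoly (deviation S s))`_1 =
  \sum_(i < 5) (bcoef i s)%:~R * ('X ^+ i.-1 *+ i - (i == 1 :> nat)%:R).
Proof.
rewrite /tpoly /deviation !raddfB /= !ev2_map !raddfD /= !lin_eval_basis.
rewrite /vec3 !inordK //= !ev2E !coefB !coef_sum.
rewrite -!sumrB; apply: eq_bigr => i _; rewrite !expr1n !mul1r.
rewrite !mulrzl !coefMrz -!mulrzBl; congr (_ *~ _).
by rewrite coef1_binom -polyC_exp coefC /= subr0 coefXn eq_sym.
Qed.

(** The factor k + 1 is the coefficient of e_1^k e_2 in (e_1 + e_2)^(k+1). At k = 0 the subtracted
    term would cancel it, hence the lower bound. *)
Lemma coef_tpoly_deviation k s : (0 < k < 4)%N ->
  (tpoly (deviation S s))`_1`_k = bcoef k.+1 s *+ k.+1.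
Proof.
move=> /andP[k_gt0 k_lt4]; rewrite tpoly_deviation coef_sum.
rewrite (bigD1 (Ordinal (k_lt4 : (k.+1 < 5)%N))) //= big1 ?addr0 => [|i ik];
  rewrite mulrzl coefMrz coefB coefMn coefXn /=.
  by rewrite eqxx eqSS gtn_eqF // mulr0n coef0 subr0 -mulrzl intz mulr_natr.
have -> : ((i == 1 :> nat)%:R : {poly int})`_k = 0.
  by case: (i == 1 :> nat); rewrite ?coef0 // coef1 gtn_eqF.
have [ki|_] := eqVneq k i.-1; last by rewrite mul0rn subr0 mul0rz.
case: i ik ki => -[|i] lti //= ik ki; first by rewrite mulr0n subr0 mul0rz.
by case/eqP: ik; apply: val_inj; rewrite /= ki.
Qed.

Lemma dev_class_deviation s : dev_class (deviation S s) = 0.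
Proof.
rewrite /dev_class !coef_tpoly_deviation //; congr (_, _).
  by rewrite rmorphMn -mulr_natr /= (_ : 2%:R = 0) ?mulr0 //; apply: val_inj.
by rewrite rmorphMn -mulr_natr /= (_ : 3%:R = 0) ?mulr0 //; apply: val_inj.
Qed.

(** A relation, so that the invariant can be computed from any convenient lift y; [has_class_uniq]
    shows that the value does not depend on the choice. *)
Definition has_class (E : extension (Gamma 4) S) (c : 'Z_2 * 'Z_3) : Prop :=
  exists y d, [/\ ext_out E (Zn 2) y = Gamma31 e0 e1,
    deviation (ext_mid E) y = ext_in E (Zn 3) d
    & dev_class d = c].

Lemma has_class_ex E : exists c, has_class E c.
Proof.
have [y yE] := ext_out_surj E (Gamma31 e0 e1).
have [|d dE] := (ext_exact (deviation (ext_mid E) y)).1; last by exists (dev_class d), y, d.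
by rewrite deviation_nat yE deviation_Gamma31.
Qed.

Lemma has_class_uniq E c c' : has_class E c -> has_class E c' -> c = c'.
Proof.
move=> [y [d [yE dE <-]]] [y' [d' [yE' dE' <-]]].
have [|s sE] := (ext_exact (y - y')).1; first by rewrite raddfB yE yE' subrr.
have dd : d - d' = deviation S s.
  by apply: (ext_in_inj (e := E)); rewrite raddfB -dE -dE' deviation_nat -sE [RHS]raddfB.
by have := dev_class_deviation s; rewrite -dd raddfB => /eqP; rewrite subr_eq0 => /eqP.
Qed.

Definition ext_class E := projT1 (cid (has_class_ex E)).

Lemma ext_classP E c : has_class E c <-> ext_class E = c.
Proof.
split=> [Ec|<-]; last exact: projT2 (cid (has_class_ex E)).
exact: has_class_uniq (projT2 (cid (has_class_ex E))) Ec.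
Qed.

Lemma ext_class_equiv E E' : ext_equiv E E' -> ext_class E = ext_class E'.
Proof.
case=> h [h_in h_out]; symmetry; apply/ext_classP.
have [y [d [yE dE dc]]] := (ext_classP E _).2 erefl.
by exists (h _ y), d; rewrite h_out -deviation_nat dE h_in.
Qed.

Lemma ext_class_baer E E' : ext_class (baer_sum E E') = ext_class E + ext_class E'.
Proof.
apply/ext_classP.
have [y [d [yE dE <-]]] := (ext_classP E _).2 erefl.
have [y' [d' [yE' dE' <-]]] := (ext_classP E' _).2 erefl.
have [p py py'] := pb_pair (etrans yE (esym yE')).
exists (quo_proj (adiag_sub E E') _ p), (d + d'); split; last by rewrite raddfD.
  by rewrite [LHS]baer_out_proj py.
rewrite -deviation_nat; apply/baer_eqP; exists (- d').
have -> : pb_fst (deviation (pullback E E') p) = ext_in E _ d.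
  by rewrite -dE -py /deviation !pb_fstB.
have -> : pb_snd (deviation (pullback E E') p) = ext_in E' _ d'.
  by rewrite -dE' -py' /deviation !pb_sndB.
by rewrite /pb_fst /pb_snd /= subr0 raddfD !raddfN opprK opprD addrA subrr sub0r.
Qed.

(** * Extensions with the same invariant *)

(** The endomorphism 24 - lam o out of E has values in the kernel of out, hence factors through S^4;
    on S^4 itself the term with lam vanishes. *)
Lemma retraction (E : extension (Gamma 4) S) :
  exists r : nat_trans (ext_mid E) S, forall V a, r V (ext_in E V a) = a *+ 24.
Proof.
have [lam lamE] := lift_24 E (fun z => @Sym_cross_effect0 4 5 z isT).
have rP V (x : ext_mid E V) : exists a, x *+ 24 - lam V (ext_out E V x) = ext_in E V a.
  by apply/ext_exact; rewrite raddfB raddfMn /= lamE subrr.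
pose r V x := projT1 (cid (rP V x)).
have rE V x : ext_in E V (r V x) = x *+ 24 - lam V (ext_out E V x).
  by rewrite /r; case: cid.
have rB V : zmod_morphism (r V).
  move=> x y; apply: (ext_in_inj (e := E)).
  by rewrite [RHS]raddfB /= !rE mulrnBl !raddfB /= opprK addrACA.
pose ra V := GRing.isZmodMorphism.Build _ _ _ (rB V).
pose rA V : {additive ext_mid E V -> S V} := HB.pack (r V) (ra V).
have rN (U V : vectType int) (f : 'Hom(U, V)) x :
    rA V (fmap (ext_mid E) f x) = fmap S f (rA U x).
  apply: (ext_in_inj (e := E)); rewrite nt_natural /= !rE raddfB raddfMn /=.
  by rewrite !nt_natural.
exists (MkNat rN) => V a; apply: (ext_in_inj (e := E)).
by rewrite /= rE ext_out_in raddf0 subr0 raddfMn.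
Qed.

Lemma ev2_10 (R : comNzRingType) s : ev2 (1 : R) 0 s = (bcoef 0 s)%:~R.
Proof.
rewrite ev2E big_ord_recl big1 ?addr0 => [|i _]; first by rewrite /= expr1n mul1r expr0 mulr1.
by rewrite expr0n /= !mulr0.
Qed.

Lemma ev2_01 (R : comNzRingType) s : ev2 (0 : R) 1 s = (bcoef 4 s)%:~R.
Proof.
rewrite ev2E big_ord_recr /= big1 => [|i _]; first by rewrite add0r expr1n mulr1 subnn mulr1.
have := ltn_ord i; rewrite -subn_gt0; case: (4 - i)%N => // k _.
by rewrite exprS !mul0r mulr0.
Qed.

Lemma ev2_11 (R : comNzRingType) s : ev2 (1 : R) 1 s = (\sum_(i < 5) bcoef i s)%:~R.
Proof. by rewrite ev2E rmorph_sum; apply: eq_bigr => i _; rewrite !expr1n !mulr1. Qed.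

Lemma coef0_intr (n : int) : (n%:~R : {poly int})`_0 = n.
Proof. by rewrite coefMrz coef1 intz. Qed.

Section Coefficients.
Variable E : extension (Gamma 4) S.
Variable r : nat_trans (ext_mid E) S.
Hypothesis r_in : forall V a, r V (ext_in E V a) = a *+ 24.

Lemma bcoef0_map (v w : Zn 2) (a b : {poly int}) s :
  lin_eval (vec2 1 'X : 'I_(dim (Zn 2)) -> _) v = a ->
  lin_eval (vec2 1 'X : 'I_(dim (Zn 2)) -> _) w = b ->
  bcoef 0 (fmap S (hom_of (vec2 v w)) s) = (ev2 a b s)`_0.
Proof. by move=> <- <-; rewrite /bcoef /ev2 ev2_map. Qed.

Lemma retraction_kernel V (x : ext_mid E V) : ext_out E V x = 0 -> exists a, r V x = a *+ 24.
Proof. by move=> /ext_exact[a ->]; exists a. Qed.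

(** Each relation between generators gives an element of the kernel, where r is divisible by 24:
    gamma_3(e_0) 0 = 0 controls b_0, gamma_3(0) e_0 = 0 controls b_4, and gamma_3(e_0) e_0 = 4
    gamma_4(e_0) controls the sum. Additivity in e_1 gives 2 b_2 and 3 b_3 as 24 times coefficients
    of d, whence 12 and 8. *)
Lemma bcoef_retraction y d x :
  ext_out E (Zn 2) y = Gamma31 e0 e1 -> deviation (ext_mid E) y = ext_in E (Zn 3) d ->
  ext_out E (Zn 2) x = Gamma4 e0 ->
  [/\ exists z, bcoef 0 (r _ y) = z *+ 24,
      exists z, bcoef 4 (r _ y) = z *+ 24,
      bcoef 2 (r _ y) = (tpoly d)`_1`_1 *+ 12,
      bcoef 3 (r _ y) = (tpoly d)`_1`_2 *+ 8 &
      exists z, \sum_(i < 5) bcoef i (r _ y) - bcoef 0 (r _ x) *+ 4 = z *+ 24].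
Proof.
move=> yE dE xE.
have ker v w : Gamma31 v w = 0 ->
    exists z, bcoef 0 (fmap S (hom_of (vec2 v w)) (r _ y)) = z *+ 24.
  move=> vw0; have [|a aE] := @retraction_kernel _ (fmap (ext_mid E) (hom_of (vec2 v w)) y).
    by rewrite nt_natural yE fmap_Gamma31 !hom_of_basis.
  by exists (bcoef 0 a); rewrite -nt_natural aE raddfMn.
have devr : deviation S (r _ y) = d *+ 24 by rewrite -deviation_nat dE r_in.
split.
- have [z] := ker e0 0 (Gamma31r0 _).
  by rewrite (bcoef0_map _ (lin_eval_basis _ _) (raddf0 _)) ev2_10 coef0_intr; exists z.
- have [z] := ker 0 e0 (Gamma310 _).
  by rewrite (bcoef0_map _ (raddf0 _) (lin_eval_basis _ _)) ev2_01 coef0_intr; exists z.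
- have := coef_tpoly_deviation (r _ y) (isT : (0 < 1 < 4)%N).
  by rewrite devr raddfMn !coefMn /=; lia.
- have := coef_tpoly_deviation (r _ y) (isT : (0 < 2 < 4)%N).
  by rewrite devr raddfMn !coefMn /=; lia.
have [|a aE] := @retraction_kernel _ (fmap (ext_mid E) (hom_of (vec2 e0 e0)) y - x *+ 4).
  by rewrite raddfB raddfMn /= nt_natural yE xE fmap_Gamma31 !hom_of_basis Gamma31_diag subrr.
move: aE; rewrite raddfB (raddfMn (r _)) /= nt_natural => aE.
exists (bcoef 0 a); rewrite -[RHS](raddfMn (bcoef 0)) -aE [RHS]raddfB (raddfMn (bcoef 0)) /=.
by rewrite (bcoef0_map _ (lin_eval_basis _ _) (lin_eval_basis _ _)) ev2_11 coef0_intr.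
Qed.

End Coefficients.

Lemma intr_Zp_eq0 p (n : int) : (1 < p)%N -> (n%:~R : 'Z_p) = 0 -> exists z, n = z *+ p.
Proof.
move=> p_gt1; rewrite {1}(divz_eq n p) rmorphD rmorphM /= -pmulrn pchar_Zp // mulr0 add0r.
move=> n0; exists (n %/ p)%Z; rewrite {1}(divz_eq n p) -mulr_natr natz.
suff -> : (n %% p)%Z = 0 by rewrite addr0.
have : (n %% p)%Z = `|(n %% p)%Z|%N by rewrite gez0_abs // modz_ge0 // -lt0n ltnW.
move: n0 (ltz_pmod n (ltnW p_gt1 : (0 < p :> int))).
case: (n %% p)%Z => // m; rewrite -pmulrn ltz_nat => m0 lt_mp _.
by have := congr1 val m0; rewrite /= val_Zp_nat // modn_small // => ->.
Qed.

Lemma bcoef0_gamma4 : bcoef 0 (sym_class (gamma4 e0)) = 1.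
Proof.
rewrite /bcoef /ev2 eval_sym_class eval_tensor_tens.
under eq_bigr => k _ do rewrite ffunE lin_eval_basis.
by rewrite big1 // coef1.
Qed.

(** * Comparison of two extensions through their maps to S^4 *)

Section Glue.
Variables E E' : extension (Gamma 4) S.
Variable r : nat_trans (ext_mid E) S.
Variable r' : nat_trans (ext_mid E') S.
Hypothesis r_in : forall V a, r V (ext_in E V a) = a *+ 24.
Hypothesis r_in' : forall V a, r' V (ext_in E' V a) = a *+ 24.

(** Both r and r' induce maps from Gamma^4 to S^4/24; g is matched exactly when the two maps agree
    at g. *)
Definition matched (V : vectType int) (g : Gamma 4 V) := exists x x',
  [/\ ext_out E V x = g, ext_out E' V x' = g & r V x = r' V x'].

Lemma matchedB V (g h : Gamma 4 V) : matched g -> matched h -> matched (g - h).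
Proof.
move=> [x [x' [<- xx' rx]]] [y [y' [<- yy' ry]]]; exists (x - y), (x' - y').
by split; rewrite raddfB ?xx' ?yy' //= rx ry raddfB.
Qed.

Lemma matched_map (U V : vectType int) (f : 'Hom(U, V)) (g : Gamma 4 U) :
  matched g -> matched (fmap (Gamma 4) f g).
Proof.
move=> [x [x' [<- xx' rx]]]; exists (fmap (ext_mid E) f x), (fmap (ext_mid E') f x').
by rewrite !nt_natural xx' rx.
Qed.

Lemma matched_div V (g : Gamma 4 V) x x' a :
  ext_out E V x = g -> ext_out E' V x' = g -> r V x - r' V x' = a *+ 24 -> matched g.
Proof.
move=> xg xg' rx; exists x, (x' + ext_in E' V a); rewrite !raddfD /= r_in' -rx ext_out_in.
by rewrite addr0 xg' addrC subrK.
Qed.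

(** Two elements with the same image in Gamma^4 differ by some a of S^4, and r' sees this difference
    as 24 a. So E' embeds into the product of Gamma^4 and S^4. *)
Lemma retraction_inj V (x' y' : ext_mid E' V) :
  ext_out E' V x' = ext_out E' V y' -> r' V x' = r' V y' -> x' = y'.
Proof.
move=> oxy rxy; apply/eqP; rewrite -subr_eq0.
have [|a aE] := (ext_exact (x' - y')).1; first by rewrite raddfB oxy subrr.
have := r_in' a; rewrite -aE raddfB rxy subrr => /esym/Sym4_torsion_free a0.
by rewrite aE a0 raddf0.
Qed.

(** Matched elements are closed under subtraction and under maps, so by [inv_span] the two
    generators suffice. The equivalence then sends x to the unique x' with the same image in Gamma^4
    and the same value in S^4. *)
Lemma glue : matched (Gamma4 e0) -> matched (Gamma31 e0 e1) -> ext_equiv E E'.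
Proof.
move=> m4 m31.
have mall V (g : Gamma 4 V) : matched g.
  pose i := sub_incl (inv_sub 4) V.
  suff [g' [eq_g mg']] : exists g', i g' = i g /\ matched g'.
    by rewrite -(val_inj eq_g).
  apply: (inv_span (Q := fun t => exists g', i g' = t /\ matched g')); last exact: valP.
  - move=> _ _ [g1 [<- m1]] [g2 [<- m2]]; exists (g1 - g2); split; last exact: matchedB.
    by rewrite raddfB.
  - move=> v; exists (Gamma4 v); split=> //.
    have := matched_map (hom_of (vec2 v 0)) m4; rewrite fmap_Gamma4.
    by rewrite hom_of_basis.
  - move=> v w; exists (Gamma31 v w); split=> //.
    have := matched_map (hom_of (vec2 v w)) m31; rewrite fmap_Gamma31.
    by rewrite !hom_of_basis.
have hP V (x : ext_mid E V) : exists x', ext_out E' V x' = ext_out E V x /\ r' V x' = r V x.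
  have [x0 [x' [ox ox' rx]]] := mall _ (ext_out E V x).
  have [|a aE] := (ext_exact (x - x0)).1; first by rewrite raddfB ox subrr.
  exists (x' + ext_in E' V a); rewrite !raddfD /= r_in' ext_out_in addr0; split=> //.
  by rewrite -r_in -aE raddfB -rx addrC subrK.
pose h V x := projT1 (cid (hP V x)).
have ho V x : ext_out E' V (h V x) = ext_out E V x by rewrite /h; case: cid => x' [].
have hr V x : r' V (h V x) = r V x by rewrite /h; case: cid => x' [].
have hB V : zmod_morphism (h V).
  by move=> x y; apply: retraction_inj; rewrite !raddfB !(ho, hr) ?raddfB //= !hr.
pose ha V := GRing.isZmodMorphism.Build _ _ _ (hB V).
pose hA V : {additive ext_mid E V -> ext_mid E' V} := HB.pack (h V) (ha V).
have hN (U V : vectType int) (f : 'Hom(U, V)) x :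
    hA V (fmap (ext_mid E) f x) = fmap (ext_mid E') f (hA U x).
  by apply: retraction_inj; rewrite /= !nt_natural !(ho, hr) nt_natural.
exists (MkNat hN); split=> [V a|V x]; last exact: ho.
by apply: retraction_inj; rewrite /= !(ho, hr) ?ext_out_in // r_in r_in'.
Qed.

End Glue.

Definition gamma_to_sym (V : vectType int) : {additive Gamma 4 V -> S V} :=
  quo_proj (coinv_sub 4) V \o sub_incl (inv_sub 4) V.

Lemma gamma_to_sym_natural (U V : vectType int) (f : 'Hom(U, V)) x :
  gamma_to_sym V (fmap (Gamma 4) f x) = fmap S f (gamma_to_sym U x).
Proof. by rewrite /gamma_to_sym /= [RHS]fmap_sym_class. Qed.

(** The canonical map Gamma^4 -> T^4 -> S^4 is composed with out, so the shift is zero on S^4 inside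
    E; it serves to adjust the value at gamma_4(e_0). *)
Lemma shift_retraction (E : extension (Gamma 4) S) (r : nat_trans (ext_mid E) S) (k : int) :
  exists r' : nat_trans (ext_mid E) S,
   forall V x, r' V x = r V x + gamma_to_sym V (ext_out E V x) *~ k.
Proof.
pose r1 V x := r V x + gamma_to_sym V (ext_out E V x) *~ k.
have rB V : zmod_morphism (r1 V).
  by move=> x y; rewrite /r1 !raddfB /= mulrzBl opprD addrACA.
pose ra V := GRing.isZmodMorphism.Build _ _ _ (rB V).
pose rA V : {additive ext_mid E V -> S V} := HB.pack (r1 V) (ra V).
have rN (U V : vectType int) (f : 'Hom(U, V)) x :
    rA V (fmap (ext_mid E) f x) = fmap S f (rA U x).
  by rewrite /= /r1 !nt_natural gamma_to_sym_natural raddfD raddfMz.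
by exists (MkNat rN).
Qed.

(** Modulo 24, b_0 and b_4 vanish, b_2 and b_3 are fixed by c2 modulo 2 and c3 modulo 3, and b_1 is
    then forced by the sum, which is 4 a. *)
Lemma divisible_coefs (b b' : nat -> int) (a a' c2 c2' c3 c3' k2 k3 : int) :
  (exists z : int, b 0%N = z *+ 24) -> (exists z : int, b 4%N = z *+ 24) ->
  b 2%N = c2 *+ 12 -> b 3%N = c3 *+ 8 ->
  (exists z : int, \sum_(i < 5) b i - a *+ 4 = z *+ 24) ->
  (exists z : int, b' 0%N = z *+ 24) -> (exists z : int, b' 4%N = z *+ 24) ->
  b' 2%N = c2' *+ 12 -> b' 3%N = c3' *+ 8 ->
  (exists z : int, \sum_(i < 5) b' i - a' *+ 4 = z *+ 24) ->
  a = a' -> c2 - c2' = k2 *+ 2 -> c3 - c3' = k3 *+ 3 ->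
  forall i, (i < 5)%N -> exists z : int, b i - b' i = z *+ 24.
Proof.
move=> [z0 b0] [z4 b4] b2 b3 [z1 b1] [z0' b0'] [z4' b4'] b2' b3' [z1' b1'] aa k2E k3E.
have sum5 (F : nat -> int) : \sum_(i < 5) F i = F 0%N + F 1%N + F 2%N + F 3%N + F 4%N.
  by rewrite !big_ord_recl big_ord0 /= addr0 !addrA.
rewrite !sum5 in b1 b1'.
case=> [|[|[|[|[|//]]]]] _.
- by exists (z0 - z0'); lia.
- by exists (z1 - z1' - (z0 - z0') - (z4 - z4') - k2 - k3); lia.
- by exists k2; lia.
- by exists k3; lia.
- by exists (z4 - z4'); lia.
Qed.

Lemma ext_class_inj E E' : ext_class E = ext_class E' -> ext_equiv E E'.
Proof.
move=> eq_class.
have [y [d [yE dE dc]]] := (ext_classP E _).2 erefl.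
have [y' [d' [yE' dE' dc']]] := (ext_classP E' _).2 erefl.
have [r r_in] := retraction E.
have [r1 r1_in] := retraction E'.
(* As pi fixes e_0 and kills e_1, any value in the image of S^4(pi) is a multiple of e_0^4, so the
   single coefficients c and c' describe the values at gamma_4(e_0). *)
pose pi := hom_of (vec2 e0 (0 : Zn 2)).
have liftx (F : extension (Gamma 4) S) : exists x, ext_out F _ (fmap (ext_mid F) pi x) = Gamma4 e0.
  have [x xE] := ext_out_surj F (Gamma4 e0); exists x.
  by rewrite nt_natural xE fmap_Gamma4 hom_of_basis.
have [x xE] := liftx E; have [x' xE'] := liftx E'.
set c := bcoef 0 (r _ (fmap (ext_mid E) pi x)).
set c' := bcoef 0 (r1 _ (fmap (ext_mid E') pi x')).
(* The canonical map sends gamma_4(e_0) to e_0^4, so a shift by c - c' makes the two values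
   equal. *)
have [r' r'E] := shift_retraction r1 (c - c').
have r'_in V a : r' V (ext_in E' V a) = a *+ 24.
  by rewrite r'E r1_in ext_out_in raddf0 mul0rz addr0.
have eq0 : c = bcoef 0 (r' _ (fmap (ext_mid E') pi x')).
  have -> : r' _ (fmap (ext_mid E') pi x') =
      r1 _ (fmap (ext_mid E') pi x') + sym_class (gamma4 e0) *~ (c - c') by rewrite r'E xE'.
  by rewrite raddfD raddfMz /= bcoef0_gamma4 intz addrC subrK.
apply: (glue r_in r'_in).
  exists (fmap (ext_mid E) pi x), (fmap (ext_mid E') pi x'); split=> //.
  move: eq0; rewrite /c !nt_natural => eq0; apply/eqP; rewrite -subr_eq0 -raddfB.
  have coef_pi i s : bcoef i (fmap S pi s) = ((bcoef 0 s)%:~R : {poly int})`_i.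
    by rewrite /bcoef /ev2 ev2_map lin_eval_basis raddf0 ev2_10.
  have [|s ->] := @bcoef_div 0 (fmap S pi (r _ x - r' _ x')); last by rewrite mulr0n.
  move=> i _; exists 0; rewrite mulr0n coef_pi.
  by move/eqP: eq0; rewrite !coef_pi !coef0_intr -subr_eq0 -raddfB => /eqP ->; rewrite coef0.
have [b0 b4 b2 b3 b1] := bcoef_retraction r_in yE dE xE.
have [b0' b4' b2' b3' b1'] := bcoef_retraction r'_in yE' dE' xE'.
have [k2 k2E] : exists k, (tpoly d)`_1`_1 - (tpoly d')`_1`_1 = k *+ 2.
  apply: intr_Zp_eq0 => //.
  have := congr1 fst (etrans dc (etrans eq_class (esym dc'))) => /= E1.
  by rewrite rmorphB /= E1 subrr.
have [k3 k3E] : exists k, (tpoly d)`_1`_2 - (tpoly d')`_1`_2 = k *+ 3.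
  apply: intr_Zp_eq0 => //.
  have := congr1 snd (etrans dc (etrans eq_class (esym dc'))) => /= E1.
  by rewrite rmorphB /= E1 subrr.
have [|a aE] := @bcoef_div 24 (r _ y - r' _ y'); last exact: matched_div yE yE' aE.
move=> i lti; rewrite (raddfB (bcoef i)).
apply: (divisible_coefs (b := fun i => bcoef i (r _ y)) (b' := fun i => bcoef i (r' _ y'))
  b0 b4 b2 b3 b1 b0' b4' b2' b3' b1' eq0 k2E k3E lti).
Qed.

(** * Extensions with a given invariant *)

Lemma lin_eval_pull (R : comNzRingType) (U V : vectType int) (f : 'Hom(U, V))
  (x : 'I_(dim V) -> R) v :
  lin_eval (pull_coords f x) v = lin_eval x (f v).
Proof.
rewrite {2}(bvec_sum v) !raddf_sum; apply: eq_bigr => i _.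
by rewrite !raddfMz /= mulrzl.
Qed.

Lemma eval_sym_tdelta (R : comNzRingType) d (V : vectType int) (x : 'I_(dim V) -> R)
  (j : {ffun 'I_d -> 'I_(dim V)}) : eval_sym x (sym_class (tdelta j)) = \prod_k x (j k).
Proof.
rewrite eval_sym_class /eval_tensor (bigD1 j) //= ffunE eqxx mul1r.
rewrite [X in _ + X]big1 ?addr0 // => i ij.
by rewrite ffunE eq_sym (negPf ij) mul0r.
Qed.

(** * Frobenius twists modulo 2 and 3 *)

Section Twist.
Variable V : vectType int.
Local Notation I := 'I_(dim V).

(* On symmetric tensors, gamma_2(u) v w |-> u v^2 w and gamma_3(u) v |-> u v^3;
   these depend on the basis and are natural only modulo 2 and 3. *)
Definition twist2 (t : tpow 4 V) : S V :=
  \sum_(i : I) \sum_(k : I) \sum_(l : I) sym_class (tdelta (mk i k k l)) *~ t (mk i i k l).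
Definition twist3 (t : tpow 4 V) : S V :=
  \sum_(i : I) \sum_(l : I) sym_class (tdelta (mk i l l l)) *~ t (mk i i i l).

Fact twist2_is_zmod_morphism : zmod_morphism twist2.
Proof.
move=> s t; rewrite /twist2 -sumrB; apply: eq_bigr => i _; rewrite -sumrB.
apply: eq_bigr => k _; rewrite -sumrB; apply: eq_bigr => l _.
by rewrite tpowB mulrzBr.
Qed.
HB.instance Definition _ := GRing.isZmodMorphism.Build (tpow 4 V) (S V) twist2
  twist2_is_zmod_morphism.

Fact twist3_is_zmod_morphism : zmod_morphism twist3.
Proof.
move=> s t; rewrite /twist3 -sumrB; apply: eq_bigr => i _; rewrite -sumrB.
by apply: eq_bigr => l _; rewrite tpowB mulrzBr.
Qed.
HB.instance Definition _ := GRing.isZmodMorphism.Build (tpow 4 V) (S V) twist3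
  twist3_is_zmod_morphism.

Variables (R : comNzRingType) (x : I -> R).

Lemma eval_twist2 t : eval_sym x (twist2 t) =
  \sum_(i : I) \sum_(k : I) \sum_(l : I) (t (mk i i k l))%:~R * (x i * x k ^+ 2 * x l).
Proof.
rewrite raddf_sum; apply: eq_bigr => i _; rewrite raddf_sum; apply: eq_bigr => k _.
rewrite raddf_sum; apply: eq_bigr => l _.
by rewrite raddfMz /= eval_sym_tdelta big4 /= !ffunE mulrzl; congr (_ *~ _); ring.
Qed.

Lemma eval_twist3 t : eval_sym x (twist3 t) =
  \sum_(i : I) \sum_(l : I) (t (mk i i i l))%:~R * (x i * x l ^+ 3).
Proof.
rewrite raddf_sum; apply: eq_bigr => i _; rewrite raddf_sum; apply: eq_bigr => l _.
by rewrite raddfMz /= eval_sym_tdelta big4 /= !ffunE mulrzl; congr (_ *~ _); ring.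
Qed.

Local Notation c v := (v2r v 0).
(** [lin_eval] of the coordinatewise product of the vectors. By Fermat, z^2 = z modulo 2 and z^3 = z
    modulo 3, so on equal arguments these reduce to [lin_eval] in characteristic 2 and 3
    respectively. *)
Definition lin_eval2 (v w : V) : R := \sum_(i : I) (c v i * c w i)%:~R * x i.
Definition lin_eval3 (u v w : V) : R := \sum_(i : I) (c u i * c v i * c w i)%:~R * x i.

Lemma prod_sum3 (a b d : I -> R) :
  (\sum_i a i) * (\sum_i b i) * (\sum_i d i) = \sum_i \sum_k \sum_l a i * b k * d l.
Proof.
rewrite big_distrlr mulr_suml; apply: eq_bigr => i _.
by rewrite mulr_suml; apply: eq_bigr => k _; rewrite mulr_sumr.
Qed.

Lemma eval_twist2_gamma4 v : eval_sym x (twist2 (gamma4 v)) =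
  lin_eval2 v v * lin_eval (fun i => x i ^+ 2) v * lin_eval x v.
Proof.
rewrite eval_twist2 prod_sum3; apply: eq_bigr => i _; apply: eq_bigr => k _.
by apply: eq_bigr => l _; rewrite gamma4E !ffunE /= !rmorphM /=; ring.
Qed.

Lemma eval_twist2_gamma31 v w : eval_sym x (twist2 (gamma31 v w)) =
  lin_eval2 v w * lin_eval (fun i => x i ^+ 2) v * lin_eval x v *+ 2 +
  lin_eval2 v v * lin_eval (fun i => x i ^+ 2) w * lin_eval x v +
  lin_eval2 v v * lin_eval (fun i => x i ^+ 2) v * lin_eval x w.
Proof.
rewrite eval_twist2 !prod_sum3 -sumrMnl -!big_split; apply: eq_bigr => i _ /=.
rewrite -sumrMnl -!big_split; apply: eq_bigr => k _ /=.
rewrite -sumrMnl -!big_split; apply: eq_bigr => l _ /=.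
by rewrite gamma31E !ffunE /= !(rmorphD, rmorphM) /=; ring.
Qed.

Lemma eval_twist3_gamma4 v : eval_sym x (twist3 (gamma4 v)) =
  lin_eval3 v v v * lin_eval (fun i => x i ^+ 3) v.
Proof.
rewrite eval_twist3 big_distrlr; apply: eq_bigr => i _; apply: eq_bigr => l _.
by rewrite gamma4E !ffunE /= !rmorphM /=; ring.
Qed.

Lemma eval_twist3_gamma31 v w : eval_sym x (twist3 (gamma31 v w)) =
  lin_eval3 v v w * lin_eval (fun i => x i ^+ 3) v *+ 3 +
  lin_eval3 v v v * lin_eval (fun i => x i ^+ 3) w.
Proof.
rewrite eval_twist3 !big_distrlr -sumrMnl -!big_split; apply: eq_bigr => i _ /=.
rewrite -sumrMnl -!big_split; apply: eq_bigr => l _ /=.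
by rewrite gamma31E !ffunE /= !(rmorphD, rmorphM) /=; ring.
Qed.

Section Frobenius.
Variables (p : nat) (pcharR : p \in [pchar R]).

Lemma intr_Fermat (z : int) : (z%:~R : R) ^+ p = z%:~R.
Proof. by rewrite -(pFrobenius_autE pcharR) rmorph_int. Qed.

Lemma lin_eval_Frobenius v : lin_eval (fun i => x i ^+ p) v = lin_eval x v ^+ p.
Proof.
rewrite /lin_eval -!(pFrobenius_autE pcharR) rmorph_sum; apply: eq_bigr => i _ /=.
by rewrite pFrobenius_autE exprMn intr_Fermat.
Qed.

End Frobenius.

Lemma lin_eval2_diag v : 2 \in [pchar R] -> lin_eval2 v v = lin_eval x v.
Proof.
by move=> R2; apply: eq_bigr => i _; rewrite -expr2 rmorphXn /= intr_Fermat.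
Qed.

Lemma lin_eval3_diag v : 3 \in [pchar R] -> lin_eval3 v v v = lin_eval x v.
Proof.
by move=> R3; apply: eq_bigr => i _; rewrite -expr2 -exprSr rmorphXn /= intr_Fermat.
Qed.

End Twist.

Lemma pchar_mpolyFp p n : prime p -> p \in [pchar {mpoly 'F_p[n]}].
Proof. by move=> pp; apply: (rmorph_pchar (@mpolyC n 'F_p)); apply: pchar_Fp. Qed.

Section Naturality.
Variables U V : vectType int.
Variable f : 'Hom(U, V).

Lemma tpow_map_gamma4 v : tpow_map f (gamma4 v) = gamma4 (f v).
Proof. exact: (congr1 (fun g : Gamma 4 V => sub_incl (inv_sub 4) V g) (fmap_Gamma4 f v)). Qed.

Lemma tpow_map_gamma31 v w : tpow_map f (gamma31 v w) = gamma31 (f v) (f w).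
Proof. exact: (congr1 (fun g : Gamma 4 V => sub_incl (inv_sub 4) V g) (fmap_Gamma31 f v w)). Qed.

(** Naturality modulo p is preserved by subtraction, so by [inv_span] it is enough to test the
    generators, and there evaluation over F_p detects divisibility by p. *)
Lemma twist_natural p (twU : {additive tpow 4 U -> S U}) (twV : {additive tpow 4 V -> S V}) :
  prime p ->
  (forall v, eval_sym (genX 'F_p (V:=V)) (fmap S f (twU (gamma4 v))) =
    eval_sym (genX 'F_p (V:=V)) (twV (gamma4 (f v)))) ->
  (forall v w, eval_sym (genX 'F_p (V:=V)) (fmap S f (twU (gamma31 v w))) =
    eval_sym (genX 'F_p (V:=V)) (twV (gamma31 (f v) (f w)))) ->
  forall t, t \in sub_pred (inv_sub 4) U ->
    exists s, fmap S f (twU t) - twV (tpow_map f t) = s *+ p.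
Proof.
move=> pp H4 H31 t; apply: (inv_span
  (Q := fun t => exists s, fmap S f (twU t) - twV (tpow_map f t) = s *+ p)).
- move=> t1 t2 [s1 E1] [s2 E2]; exists (s1 - s2).
  by rewrite mulrnBl -E1 -E2 !raddfB /= !opprK addrACA.
- by move=> v; apply: (eval_sym_divp pp); rewrite raddfB /= H4 tpow_map_gamma4 subrr.
- by move=> v w; apply: (eval_sym_divp pp); rewrite raddfB /= H31 tpow_map_gamma31 subrr.
Qed.

(** In characteristic 2 the values on generators become coordinate-free products of [lin_eval] and
    its square; the mixed term [lin_eval2 x v w] carries a factor 2. *)
Lemma twist2_natural t : t \in sub_pred (inv_sub 4) U ->
  exists s, fmap S f (twist2 t) - twist2 (tpow_map f t) = s *+ 2.
Proof.
have R2 := @pchar_mpolyFp 2 (dim V) isT.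
apply: (@twist_natural 2 (@twist2 U) (@twist2 V) isT) => [v|v w]; rewrite eval_sym_map.
  rewrite [LHS]eval_twist2_gamma4 [RHS]eval_twist2_gamma4 !(lin_eval2_diag _ _ R2).
  by rewrite !(lin_eval_Frobenius _ R2) lin_eval_pull.
rewrite [LHS]eval_twist2_gamma31 [RHS]eval_twist2_gamma31 !(lin_eval2_diag _ _ R2).
by rewrite !(lin_eval_Frobenius _ R2) !lin_eval_pull !(mulrn_pchar R2).
Qed.

Lemma twist3_natural t : t \in sub_pred (inv_sub 4) U ->
  exists s, fmap S f (twist3 t) - twist3 (tpow_map f t) = s *+ 3.
Proof.
have R3 := @pchar_mpolyFp 3 (dim V) isT.
apply: (@twist_natural 3 (@twist3 U) (@twist3 V) isT) => [v|v w]; rewrite eval_sym_map.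
  rewrite [LHS]eval_twist3_gamma4 [RHS]eval_twist3_gamma4 !(lin_eval3_diag _ _ R3).
  by rewrite !(lin_eval_Frobenius _ R3) lin_eval_pull.
rewrite [LHS]eval_twist3_gamma31 [RHS]eval_twist3_gamma31 !(lin_eval3_diag _ _ R3).
by rewrite !(lin_eval_Frobenius _ R3) !lin_eval_pull !(mulrn_pchar R3).
Qed.

End Naturality.

Lemma v2r_basis n (i j : 'I_n) : v2r (basis i) 0 (j : 'I_(dim (Zn n))) = (j == i)%:R.
Proof. exact: v2r_bvec. Qed.

Lemma lin_eval2_basis (R : comNzRingType) n (x : 'I_(dim (Zn n)) -> R) (i : 'I_n) w :
  lin_eval2 x (basis i) w = (v2r w 0 (i : 'I_(dim (Zn n))))%:~R * x i.
Proof.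
rewrite /lin_eval2 (bigD1 (i : 'I_(dim (Zn n)))) //= v2r_basis eqxx mul1r big1 ?addr0 // => j ji.
by rewrite v2r_basis (negPf ji) !mul0r.
Qed.

Lemma lin_eval3_basis (R : comNzRingType) n (x : 'I_(dim (Zn n)) -> R) (i : 'I_n) w :
  lin_eval3 x (basis i) (basis i) w = (v2r w 0 (i : 'I_(dim (Zn n))))%:~R * x i.
Proof.
rewrite /lin_eval3 (bigD1 (i : 'I_(dim (Zn n)))) //= v2r_basis eqxx !mul1r big1 ?addr0 // => j ji.
by rewrite v2r_basis (negPf ji) !mul0r.
Qed.

(** * The extension attached to a pair of residues *)

Section TwistedExtension.
Variables a b : int.

(** Multiplication by 3 and by 2 embeds S^4/2 and S^4/3 into S^4/6, so only the result modulo 6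
    matters. *)
Definition twist (V : vectType int) (g : Gamma 4 V) : S V :=
  twist2 (sub_incl (inv_sub 4) V g) *~ (a * 3) + twist3 (sub_incl (inv_sub 4) V g) *~ (b * 2).

Fact twist_is_zmod_morphism V : zmod_morphism (@twist V).
Proof.
by move=> g h; rewrite /twist !raddfB /= !mulrzBl opprD addrACA.
Qed.
HB.instance Definition _ (V : vectType int) := GRing.isZmodMorphism.Build (Gamma 4 V) (S V)
  (@twist V) (@twist_is_zmod_morphism V).

Lemma twist_map (U V : vectType int) (f : 'Hom(U, V)) g :
  exists s, fmap S f (twist g) - twist (fmap (Gamma 4) f g) = s *+ 6.
Proof.
have [s2 E2] := twist2_natural f (sub_incl_in g).
have [s3 E3] := twist3_natural f (sub_incl_in g).
exists (s2 *~ a + s3 *~ b); rewrite /twist (nt_natural (sub_incl (inv_sub 4))) raddfD !raddfMz.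
rewrite opprD addrACA -!mulrzBl E2 E3 mulrnDl.
by rewrite !pmulrn -!mulrzA; congr (_ *~ _ + _ *~ _); lia.
Qed.

(** The pullback of S^4 -> S^4/6 along [twist], as pairs subject to a congruence; [twist_map] shows
    that maps preserve this congruence. *)
Definition tw_pred (V : vectType int) : {pred dsum S (Gamma 4) V} :=
  [pred x : dsum S (Gamma 4) V | `[< exists s, x.1 - twist x.2 = s *+ 6 >]].

Fact tw_zmod_closed V : zmod_closed (@tw_pred V).
Proof.
split=> [|x y]; rewrite !inE.
  by apply/asboolP; exists 0; rewrite mul0rn /= raddf0 subrr.
move=> /asboolP[s sE] /asboolP[t tE]; apply/asboolP; exists (s - t).
by rewrite mulrnBl -sE -tE dsumB /= (raddfB (@twist V)) !opprD !opprK addrACA.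
Qed.

Fact tw_stable (U V : vectType int) (f : 'Hom(U, V)) (x : dsum S (Gamma 4) U) :
  x \in @tw_pred U -> fmap (dsum S (Gamma 4)) f x \in @tw_pred V.
Proof.
rewrite !inE => /asboolP[s sE]; apply/asboolP; have [t tE] := twist_map f x.2.
exists (fmap S f s + t); rewrite mulrnDl -tE -raddfMn -sE raddfB /=.
by rewrite addrA subrK.
Qed.

Definition tw_sub := @MkSub (dsum S (Gamma 4)) tw_pred tw_zmod_closed tw_stable.
Definition tw_mid : Fun := sub_fun tw_sub.

Fact tw_in_subproof (V : vectType int) (s : S V) : (s *+ 6, 0) \in sub_pred tw_sub V.
Proof. by apply/asboolP; exists s; rewrite /= raddf0 subr0. Qed.

(** The kernel of the projection to Gamma^4 consists of the pairs (6 s, 0), a copy of S^4 because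
    S^4 is torsion free. *)
Definition tw_in_fun (V : vectType int) (s : S V) : tw_mid V :=
  exist (fun x => x \in sub_pred tw_sub V) _ (tw_in_subproof s).

Fact tw_in_is_zmod_morphism V : zmod_morphism (@tw_in_fun V).
Proof.
move=> s t; apply: val_inj; rewrite -[RHS]/(sub_incl tw_sub V _) [RHS]raddfB.
by rewrite [RHS]dsumB /= mulrnBl subr0.
Qed.
HB.instance Definition _ (V : vectType int) := GRing.isZmodMorphism.Build (S V) (tw_mid V)
  (@tw_in_fun V) (@tw_in_is_zmod_morphism V).

Fact tw_in_natural (U V : vectType int) (f : 'Hom(U, V)) s :
  tw_in_fun (fmap S f s) = fmap tw_mid f (tw_in_fun s).
Proof. by apply: val_inj; rewrite /= /dsum_map /= raddf0 raddfMn. Qed.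

Definition tw_in := @MkNat S tw_mid (fun V => @tw_in_fun V) tw_in_natural.

Definition tw_out_fun (V : vectType int) (x : tw_mid V) : Gamma 4 V := (sub_incl tw_sub V x).2.

Fact tw_out_is_zmod_morphism V : zmod_morphism (@tw_out_fun V).
Proof. by move=> x y; rewrite /tw_out_fun raddfB. Qed.
HB.instance Definition _ (V : vectType int) := GRing.isZmodMorphism.Build (tw_mid V) (Gamma 4 V)
  (@tw_out_fun V) (@tw_out_is_zmod_morphism V).

Fact tw_out_natural (U V : vectType int) (f : 'Hom(U, V)) x :
  tw_out_fun (fmap tw_mid f x) = fmap (Gamma 4) f (tw_out_fun x).
Proof. by rewrite /tw_out_fun nt_natural. Qed.

Definition tw_out := @MkNat tw_mid (Gamma 4) (fun V => @tw_out_fun V) tw_out_natural.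

Fact tw_in_inj V : injective (tw_in V).
Proof.
move=> s t /(congr1 (fun x : tw_mid V => (sub_incl tw_sub V x).1)) /= st.
by apply/eqP; rewrite -subr_eq0; apply/eqP/(@Sym4_torsion_free _ _ 5); rewrite mulrnBl st subrr.
Qed.

Fact tw_lift_subproof (V : vectType int) (g : Gamma 4 V) : (twist g, g) \in sub_pred tw_sub V.
Proof. by apply/asboolP; exists 0; rewrite /= subrr mul0rn. Qed.

Definition tw_lift (V : vectType int) (g : Gamma 4 V) : tw_mid V :=
  exist (fun x => x \in sub_pred tw_sub V) _ (tw_lift_subproof g).

Fact tw_out_surj V (g : Gamma 4 V) : exists x, tw_out V x = g.
Proof. by exists (tw_lift g). Qed.

Fact tw_exact V (x : tw_mid V) : tw_out V x = 0 <-> exists s, x = tw_in V s.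
Proof.
split=> [x2|[s ->]] //; have /asboolP[s] := sub_incl_in x.
rewrite /= -[(val x).2]/(tw_out V x) x2 raddf0 subr0 => sE; exists s.
by apply: val_inj; rewrite [LHS]surjective_pairing; congr (_, _).
Qed.

Definition twisted_ext : extension (Gamma 4) S :=
  @MkExt (Gamma 4) S tw_mid tw_in tw_out tw_in_inj tw_out_surj tw_exact.

(** The lift (twist g, g) of g = gamma_3(e_0) e_1 has deviation 6 d in S^4. With b_2 = 3 a and b_3 =
    2 b the relevant coefficients of 6 d are 2 * 3 a and 3 * 2 b, so those of d are a and b. *)
Lemma ext_class_twisted : ext_class twisted_ext = (a%:~R, b%:~R).
Proof.
apply/ext_classP; pose y := tw_lift (Gamma31 e0 e1).
have [|d dE] := (ext_exact (e := twisted_ext) (deviation tw_mid y)).1.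
  by rewrite deviation_nat deviation_Gamma31.
exists y, d; split=> //.
have dr : deviation S (twist (Gamma31 e0 e1)) = d *+ 6.
  exact: (congr1 (fun x : tw_mid (Zn 3) => (sub_incl tw_sub _ x).1) dE).
(* On gamma_3(e_0) e_1, [twist2] gives e_0^2 e_1^2 + e_0^3 e_1 and [twist3] gives e_0 e_1^3; here
   e_0 = 1 and e_1 = 'X. *)
have cE i : bcoef i (twist (Gamma31 e0 e1)) =
    ('X^2 + 'X : {poly int})`_i *~ (a * 3) + ('X^3 : {poly int})`_i *~ (b * 2).
  rewrite raddfD !raddfMz -[sub_incl _ _ _]/(gamma31 e0 e1) /= {1 2}/bcoef /ev2.
  rewrite eval_twist2_gamma31 eval_twist3_gamma31 !lin_eval2_basis
    !lin_eval3_basis !lin_eval_basis /vec2 /=.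
  rewrite !v2r_basis !eqxx /=.
  by rewrite ?(mul0r, mul1r, mulr1, expr1n, mul0rn, add0r).
have := coef_tpoly_deviation (twist (Gamma31 e0 e1)) (isT : (0 < 1 < 4)%N).
have := coef_tpoly_deviation (twist (Gamma31 e0 e1)) (isT : (0 < 2 < 4)%N).
rewrite dr raddfMn !coefMn !cE !coefD !coefX !coefXn /= => E3 E2.
rewrite ?(addr0, add0r, mul0rz, intz) in E2 E3.
have six2 (q : int) : q *+ 6 = a * 3 *+ 2 -> q = a by lia.
have six3 (q : int) : q *+ 6 = b * 2 *+ 3 -> q = b by lia.
by rewrite /dev_class; congr (_ %:~R, _ %:~R); [apply: six2 E2 | apply: six3 E3].
Qed.

End TwistedExtension.

Lemma ext_class_surj c : exists E, ext_class E = c.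
Proof.
case: c => [c2 c3]; exists (twisted_ext (c2 : nat) (c3 : nat)).
by rewrite ext_class_twisted -!pmulrn !natr_Zp.
Qed.

Theorem mainTheorem6 : Ext1_isog (Gamma 4) (Sym 4) ('Z_2 * 'Z_3)%type.
Proof.
exists ext_class; split=> [E E'|c|E E']; [|exact: ext_class_surj|exact: ext_class_baer].
by split; [exact: ext_class_inj | exact: ext_class_equiv].
Qed.
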